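(* Let $\mathcal N\subseteq\mathcal X^2$ be a symmetric neighbor relation, $Q$ a probability measure on $\mathcal Z$, and $P_{Z|X}$ a Markov kernel with $P_{Z|X}(\cdot|x)\ll Q$ for all $x$. If $P_{Z|X}$ is $(\varepsilon,\delta)$-DP with respect to $\mathcal N$, then for every $\alpha>1$ the PPR-compressed mechanism $x\mapsto((Z_i)_{i\ge1},K)$ is $(2\alpha\varepsilon,\,2\delta)$-DP with respect to $\mathcal N$.
   Context: A Markov kernel $P_{W|X}$ is $(\varepsilon,\delta)$-DP w.r.t. a symmetric relation $\mathcal N\subseteq\mathcal X^2$ if $\Pr(W\in S\mid X=x)\le e^{\varepsilon}\Pr(W\in S\mid X=x')+\delta$ for all $(x,x')\in\mathcal N$ and measurable $S$; $\varepsilon$-DP means $(\varepsilon,0)$-DP. PPR: let $Z_1,Z_2,\ldots$ be i.i.d. $\sim Q$, independent of the points $T_1\le T_2\le\cdots$ of a rate-$1$ Poisson process on $[0,\infty)$. For input $x$, with $P=P_{Z|X}(\cdot|x)$, set $\tilde T_i:=T_i(\frac{\mathrm dP}{\mathrm dQ}(Z_i))^{-1}$ ($:=\infty$ if the derivative is $0$, $\infty^{-\alpha}:=0$), and draw $K$ with $\Pr(K=k\mid (Z_i,T_i)_i)=\tilde T_k^{-\alpha}/\sum_i\tilde T_i^{-\alpha}$ (fresh randomness for each input). The PPR-compressed mechanism is the kernel $x\mapsto((Z_i)_{i\ge1},K)$; the shared sequence $(Z_i)$ does not depend on $x$.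
   Formalization: The formal theorem assumes ε ≥ 0 (and δ ≥ 0), the usual convention for differential privacy; for negative ε the claim as stated fails, e.g. for a constant kernel P = Q with ε = −0.1, δ = 1 − e^ε and α = 10. *)

(* Defs.v *)
From HB Require Import structures.
From mathcomp Require Import all_boot all_order all_algebra.
From mathcomp Require Import all_classical all_reals all_analysis.
From mathcomp Require Import exponential_distribution.
Set Implicit Arguments. Unset Strict Implicit. Unset Printing Implicit Defensive.
Import Order.TTheory GRing.Theory Num.Theory.
Import numFieldNormedType.Exports.
Local Open Scope classical_set_scope.
Local Open Scope ring_scope.

Definition symmetric_rel {X : Type} (N : X -> X -> Prop) :=
  forall x x', N x x' -> N x' x.

(* (eps,delta)-DP of a mechanism M : X -> (set U -> \bar R) (M x S = Pr(W in S | X = x)),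
   w.r.t. the neighbour relation N, where measU is the class of measurable sets of U. *)
Definition DP {R : realType} {X U : Type} (measU : set U -> Prop)
  (N : X -> X -> Prop) (M : X -> set U -> \bar R) (eps delta : R) :=
  forall x x', N x x' -> forall S, measU S ->
    (M x S <= (expR eps)%:E * M x' S + delta%:E)%E.

(* Measurable sets of the output space Z^N x N of the PPR-compressed mechanism:
   the sigma-algebra generated by the cylinders
   {((z_i)_i, k) | k = k0 /\ z_i \in A_i for i < n}, A_i measurable
   (= product sigma-algebra of the cylinder sigma-algebra on Z^N and the
   discrete sigma-algebra on N). *)
Definition ppr_cylinders {d} (Z : measurableType d) : set (set ((nat -> Z) * nat)) :=
  [set S | exists (n : nat) (A : nat -> set Z) (k0 : nat),
      (forall i, measurable (A i)) /\
      S = [set p | p.2 = k0 /\ forall i, (i < n)%N -> A i (p.1 i)]].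
Arguments ppr_cylinders {d} Z.

Definition ppr_measurable {d} (Z : measurableType d) : set (set ((nat -> Z) * nat)) :=
  smallest (sigma_algebra setT) (ppr_cylinders Z).
Arguments ppr_measurable {d} Z.

(* The source of randomness on a probability space (Omega, Pr):
   Zs 0, Zs 1, ... are i.i.d. ~ Q, E 0, E 1, ... are i.i.d. ~ Exp(1), and the two
   families are mutually independent (stated as the joint law of every finite
   initial segment). The Poisson points are T_i = E_0 + ... + E_i. *)
Definition ppr_source {R : realType} {d dO} {Z : measurableType d}
  {Omega : measurableType dO} (Pr : probability Omega R) (Q : probability Z R)
  (Zs : nat -> Omega -> Z) (E : nat -> Omega -> R) :=
  [/\ (forall i, measurable_fun setT (Zs i)),
      (forall i, measurable_fun setT (E i)) &
      forall (n : nat) (A : nat -> set Z) (B : nat -> set R),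
        (forall i, measurable (A i)) -> (forall i, measurable (B i)) ->
        Pr (\bigcap_(i in `I_n) (Zs i @^-1` A i `&` E i @^-1` B i)) =
        (\prod_(i < n) (fine (Q (A i)) * fine (exponential_prob 1 (B i))))%:E].

(* Points of the rate-1 Poisson process (index shifted: T i is the paper's T_{i+1}). *)
Definition ppr_T {R : realType} {Omega : Type} (E : nat -> Omega -> R) (i : nat) (w : Omega) : R :=
  \sum_(j < i.+1) E j w.

(* PPR weight  Ttilde_k^{-alpha} = T_k^{-alpha} (dP/dQ (Z_k))^alpha  (= 0 when dP/dQ (Z_k) = 0). *)
Definition ppr_weight {R : realType} {X Omega Z : Type} (Zs : nat -> Omega -> Z)
  (E : nat -> Omega -> R) (f : X -> Z -> R) (alpha : R) (x : X) (k : nat) (w : Omega) : R :=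
  powR (f x (Zs k w)) alpha * powR (ppr_T E k w) (- alpha).

(* The PPR-compressed mechanism x |-> ((Z_i)_i, K), where given (Z_i,T_i)_i the index K
   is drawn with Pr(K = k) = Ttilde_k^{-alpha} / sum_i Ttilde_i^{-alpha}:
   Pr(((Z_i)_i, K) \in S | X = x)
     = E_Pr [ sum_k 1_S((Z_i)_i, k) * Ttilde_k^{-alpha} / sum_i Ttilde_i^{-alpha} ]. *)
Definition ppr_mech {R : realType} {X : Type} {d dO} {Z : measurableType d}
  {Omega : measurableType dO} (Pr : probability Omega R) (Zs : nat -> Omega -> Z)
  (E : nat -> Omega -> R) (f : X -> Z -> R) (alpha : R)
  (x : X) (S : set ((nat -> Z) * nat)) : \bar R :=
  (\int[Pr]_w
     (\sum_(k <oo)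
        ((\1_S ((fun i => Zs i w), k) : R)%:E * (ppr_weight Zs E f alpha x k w)%:E
         / (\sum_(i <oo) (ppr_weight Zs E f alpha x i w)%:E))))%E.

(* Main.v *)
Require Import Defs.
From HB Require Import structures.
From mathcomp Require Import all_boot all_order all_algebra.
From mathcomp Require Import all_classical all_reals all_analysis.
From mathcomp Require Import measurable_realfun exponential_distribution.
From mathcomp Require Import ring lra.
Import Order.TTheory GRing.Theory Num.Theory.
Import numFieldNormedType.Exports.
Set Implicit Arguments. Unset Strict Implicit. Unset Printing Implicit Defensive.
Local Open Scope classical_set_scope.
Local Open Scope ring_scope.

(** Write [f], [g] for the densities at two neighbouring inputs and let [rho] be
    [f] truncated to the band [[g / e^eps, e^eps g]], so that
    [int |f - rho| dQ <= 2 delta]. Since weights are [alpha]-homogeneous in the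
    density, passing from [rho] to [g] changes numerators and denominators by at
    most [e^(alpha eps)] pointwise, which costs the factor [e^(2 alpha eps)].

    Passing from [f] to [rho] costs at most [int |f - rho| dQ] in total
    variation. With [sigma = max f rho], [tau = min f rho] and weights [m], [n]
    of [sigma], [tau], both selection probabilities of [k] are at least
    [q_k = n_k / (n_k + sum_(j != k) m_j)]. The Mecke equation for the marked
    Poisson process and the substitution [t = tau(z) u] give
    [E sum_k q_k = C int tau dQ] with [C] depending only on [sigma]; for
    [tau = sigma] this is at most [1], hence [C <= 1] because [int sigma dQ >= 1],
    and the loss is at most [C int (sigma - tau) dQ].

    The Mecke equation itself only needs that inserting a point in a spacing
    preserves the law: [e^-(u + v) du dv] is the law of two independent
    exponential spacings. *)

(** * Lebesgue integration *)

(* The canonical measure structure on [pushforward mu phi] leaves the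
   measurability of [phi] as a unification hole; here it is an argument. *)
Definition image_measure {R : realType} d1 d2 (T1 : measurableType d1)
    (T2 : measurableType d2) (mu : {measure set T1 -> \bar R}) (phi : T1 -> T2)
    (mphi : measurable_fun setT phi) : {measure set T2 -> \bar R} :=
  measure_function_pushforward__canonical__measure_function_Measure mu mphi.

Lemma ge0_integral_image_measure {R : realType} d1 d2 (T1 : measurableType d1)
    (T2 : measurableType d2) (mu : {measure set T1 -> \bar R}) (phi : T1 -> T2)
    (mphi : measurable_fun setT phi) (f : T2 -> \bar R) :
  measurable_fun setT f -> (forall x, 0 <= f x)%E ->
  (\int[image_measure mu mphi]_y f y = \int[mu]_x f (phi x))%E.
Proof. by move=> mf f0; rewrite ge0_integral_pushforward. Qed.

Section lebesgue_affine.
Local Open Scope ereal_scope.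
Context {R : realType}.
Local Notation mu := (@lebesgue_measure R).

Lemma lebesgue_measure_shift (a : R) (A : set R) : measurable A ->
  pushforward mu (fun x : measurableTypeR R => x + a : measurableTypeR R)%R A
  = mu A.
Proof.
move=> mA.
have mphi : measurable_fun setT (fun x : measurableTypeR R => x + a : measurableTypeR R)%R.
  by apply: measurable_funD.
apply/esym.
apply: (@lebesgue_measure_unique R (image_measure mu mphi)) => //= _ [[b c]] _ <-.
rewrite /pushforward/=.
rewrite (_ : _ @^-1` _ = [set` `](b - a)%R, (c - a)%R]]); last first.
  by apply/seteqP; split => x /=; rewrite !in_itv/= ltrBlDr lerBrDr.
rewrite !lebesgue_measure_itv/= !lte_fin ltrD2r; case: ifPn => // _.
by rewrite -!EFinD; congr EFin; ring.
Qed.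

Lemma ge0_integral_shift (a : R) (f : R -> \bar R) :
  measurable_fun setT f -> (forall x, 0 <= f x) ->
  \int[mu]_x f x = \int[mu]_x f (x + a)%R.
Proof.
move=> mf f0.
have mphi : measurable_fun setT (fun x : measurableTypeR R => x + a : measurableTypeR R)%R.
  by apply: measurable_funD.
transitivity (\int[image_measure mu mphi]_x f x).
  by apply: eq_measure_integral => A mA _; apply/esym/lebesgue_measure_shift.
by rewrite ge0_integral_image_measure.
Qed.

Lemma ge0_integral_scale (c : R) (f : R -> \bar R) : (0 < c)%R ->
  measurable_fun setT f -> (forall x, 0 <= f x) ->
  \int[mu]_x f x = c%:E * \int[mu]_x f (c * x)%R.
Proof.
move=> c0 mf f0.
have mphi : measurable_fun setT (fun x : measurableTypeR R => c * x : measurableTypeR R)%R.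
  by apply: measurable_funM.
pose k : {nonneg R} := NngNum (ltW c0).
transitivity (\int[mscale k (image_measure mu mphi)]_x f x).
  apply: eq_measure_integral => A mA _.
  apply: (@lebesgue_measure_unique R (mscale k (image_measure mu mphi))) => //= _ [[a b]] _ <-.
  rewrite /mscale/= /pushforward/=.
  rewrite (_ : _ @^-1` _ = [set` `](c^-1 * a)%R, (c^-1 * b)%R]]); last first.
    apply/seteqP; split => x /=; rewrite !in_itv/= ltr_pdivrMl// ler_pdivlMl//.
  rewrite !lebesgue_measure_itv/= !lte_fin ltr_pM2l ?invr_gt0//.
  case: ifPn => _; last by rewrite mule0.
  by rewrite -!EFinD -EFinM; congr EFin; field; rewrite gt_eqF.
by rewrite ge0_integral_mscale//= ge0_integral_image_measure.
Qed.

End lebesgue_affine.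

(** * Restricted integrals and measurability of the inverse *)

Section misc_integral.
Local Open Scope ereal_scope.
Context d (T : measurableType d) (R : realType).
Implicit Types mu : {measure set T -> \bar R}.

Lemma ge0_integral_mrestr mu (D : set T) (mD : measurable D) (f : T -> \bar R) :
  measurable_fun setT f -> (forall x, 0 <= f x) ->
  \int[mrestr mu mD]_x f x = \int[mu]_(x in D) f x.
Proof.
move=> mf f0; rewrite -(setUv D) ge0_integral_setU//=; last 3 first.
- exact: measurableC.
- by rewrite setUv.
- exact/disj_setPCl.
rewrite [X in _ + X]null_set_integral ?adde0//; last 3 first.
- exact: measurableC.
- exact: measurable_funTS.
- by rewrite /= /mrestr setICl measure0.
by apply: eq_measure_integral => A mA AD; rewrite /= /mrestr setIidl.
Qed.

Lemma integral_mkif mu (D : set T) (b : T -> bool) (f : T -> \bar R) :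
  (forall x, D x <-> b x) ->
  \int[mu]_(x in D) f x = \int[mu]_x (if b x then f x else 0).
Proof.
move=> Db; rewrite integral_mkcond; apply: eq_integral => x _.
rewrite patchE; case: ifPn.
  by rewrite inE => /Db ->.
by rewrite notin_setE => nD; case: ifPn => // /Db.
Qed.

Lemma measurable_inve (f : T -> \bar R) :
  measurable_fun setT f -> measurable_fun setT (fun x => (f x)^-1).
Proof.
move=> mf.
have mc (c : \bar R) : measurable_fun setT (fun x => f x == c).
  apply: (measurable_fun_bool true) => //.
  rewrite setTI (_ : _ @^-1` _ = f @^-1` [set c]).
    by rewrite -[X in measurable X]setTI; apply: mf.
  by apply/seteqP; split => x /= /eqP.
rewrite (_ : (fun x => _) = fun x => if f x == 0 then +oo else
    if f x == +oo then 0 else if f x == -oo then -oo else ((fine (f x))^-1)%:E).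
  apply: measurable_fun_ifT => //.
  apply: measurable_fun_ifT => //.
  apply: measurable_fun_ifT => //.
  apply/measurable_EFinP.
  (* Measurability of the real inverse is taken from [powR] with exponent -1, which is the inverse
     only on nonnegative bases, so negative values are reflected. *)
  rewrite (_ : (fun x => _) = fun x =>
      ((fine (f x)) `^ (-1) *+ (0 <= fine (f x))%R -
       (- (fine (f x))) `^ (-1) *+ (fine (f x) < 0)%R)%R); last first.
    apply/funext => x /=; case: leP => h; first by rewrite powR_inv1// mulr1n mulr0n subr0.
    by rewrite mulr0n mulr1n sub0r powR_inv1 ?oppr_ge0 ?ltW// invrN opprK.
  have mff : measurable_fun setT (fun x => fine (f x)) by apply: measurableT_comp.
  apply: measurable_funB.
  - rewrite (_ : (fun x => _) = fun x => if (0 <= fine (f x))%R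
        then (fine (f x)) `^ (-1) else 0%R)%R; last first.
      by apply/funext => x; case: ifP.
    apply: measurable_fun_ifT => //; first exact: measurable_fun_ler.
    exact: (measurableT_comp (measurable_powR _)).
  - rewrite (_ : (fun x => _) = fun x => if (fine (f x) < 0)%R
        then (- fine (f x)) `^ (-1) else 0%R)%R; last first.
      by apply/funext => x; case: ifP.
    apply: measurable_fun_ifT => //; first exact: measurable_fun_ltr.
    apply: (measurableT_comp (measurable_powR _)) => //.
    exact: measurable_funN.
apply/funext => x; case: (inveP (f x)); rewrite ?eqxx//.
by move=> r r0; rewrite eqe (negbTE r0).
Qed.

End misc_integral.

(** * Sequences of marked spacings *)

Section exponential_law.
Local Open Scope ereal_scope.
Context {R : realType}.
Local Notation mu := (@lebesgue_measure R).

Lemma exponential_probE (B : set R) : exponential_prob 1 B =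
  \int[mu]_x (if x \in B then (exponential_pdf 1 x)%:E else 0).
Proof.
apply: (@integral_mkif _ (measurableTypeR R) R mu B (fun x => x \in B)
  (fun x => (exponential_pdf 1 x)%:E)) => x.
by split => [/mem_set|/set_mem].
Qed.

Lemma measurable_mem d (T : measurableType d) (B : set T) :
  measurable B -> measurable_fun setT (fun x => x \in B).
Proof.
move=> mB; apply: (measurable_fun_bool true) => //.
rewrite setTI (_ : _ @^-1` _ = B)//.
by apply/seteqP; split => x /= => [/set_mem|/mem_set].
Qed.

(** Memorylessness: after translation by [u] the density factors as [e^-u] times itself. At negative
    arguments the left indicator fails and the right density is 0. *)
Lemma exponential_prob_shift (u : R) (B : set R) : (0 <= u)%R -> measurable B ->
  exponential_prob 1 [set e | (u <= e)%R /\ B (e - u)%R] =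
  (expR (- u))%:E * exponential_prob 1 B.
Proof.
move=> u0 mB; rewrite !exponential_probE.
have pdf0 x : 0 <= (@exponential_pdf R 1 x)%:E.
  by rewrite lee_fin exponential_pdf_ge0.
have mpdf : measurable_fun setT (fun x => (@exponential_pdf R 1 x)%:E).
  by apply/measurable_EFinP; exact: measurable_exponential_pdf.
rewrite (@ge0_integral_shift R u); last 2 first.
- apply: measurable_fun_ifT => //; apply: measurable_mem.
  rewrite (_ : [set e | _] = [set e | (u <= e)%R] `&` (fun e => e - u)%R @^-1` B)//.
  apply: measurableI.
    rewrite (_ : [set e | _] = `[u, +oo[%classic)//.
    by apply/seteqP; split => x /=; rewrite in_itv/= andbT.
  rewrite -[X in measurable X]setTI.
  have : measurable_fun setT (fun e : R => e - u)%R by exact: measurable_funB.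
  exact.
- by move=> x; case: ifP.
rewrite -ge0_integralZl//; last 2 first.
- by apply: measurable_fun_ifT => //; exact: measurable_mem.
- by move=> x _; case: ifP.
apply: eq_integral => x _.
case: (ltP x 0%R) => x0.
  rewrite [X in if X then _ else _](_ : _ = false); last first.
    by apply/negbTE; rewrite notin_setE/= lerDr => -[]; rewrite leNgt x0.
  by case: ifP; rewrite ?mule0// lt0_exponential_pdf// mule0.
rewrite (_ : ((x + u)%R \in _) = (x \in B)); last first.
  by apply/idP/idP; rewrite !inE/= addrK lerDr// => -[].
case: ifP; rewrite ?mule0// => _.
rewrite !exponential_pdfE ?addr_ge0// -EFinM; congr EFin.
by rewrite !mul1r !mulN1r opprD expRD mulrC.
Qed.

(** The endpoint 0 is null, so the density can be restricted to [0 < u], the range of the insertion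
    distances below. *)
Lemma exponential_prob_gt0E (B : set R) : measurable B ->
  exponential_prob 1 B =
  \int[mu]_u (if (0 < u)%R && (u \in B) then (expR (- u))%:E else 0).
Proof.
move=> mB; rewrite exponential_probE.
have mx : measurable_fun setT (fun u : R => (expR (- u))%:E).
  apply/measurable_EFinP; apply: measurableT_comp => //.
apply: ae_eq_integral => //.
- apply: measurable_fun_ifT => //; first exact: measurable_mem.
  by apply/measurable_EFinP; exact: measurable_exponential_pdf.
- apply: measurable_fun_ifT => //; apply: measurable_and.
    exact: measurable_fun_ltr.
  exact: measurable_mem.
exists [set 0%R]; split; [exact: measurable_set1|exact: lebesgue_measure_set1|].
move=> x /=; apply: contra_notP => /eqP x0 _.
case: (ltgtP x 0%R) x0 => //= h _.
  by case: ifP => // _; rewrite lt0_exponential_pdf.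
by case: ifP => // _; rewrite exponential_pdfE ?ltW// mul1r mulN1r.
Qed.

End exponential_law.

(** These are the events whose probabilities [ppr_source] prescribes. They form a pi-system, so they
    determine the law of the whole sequence. *)
Definition zt_cylinders {R : realType} {d} (Z : measurableType d) :
    set (set (nat -> Z * R)) :=
  [set S | exists (n : nat) (A : nat -> set Z) (B : nat -> set R),
    [/\ forall i, measurable (A i), forall i, measurable (B i) &
      S = [set s | forall i, (i < n)%N -> A i (s i).1 /\ B i (s i).2]]].

Definition zt_seq (R : realType) {d} (Z : measurableType d) :=
  g_sigma_algebraType (@zt_cylinders R d Z).
HB.instance Definition _ (R : realType) d (Z : measurableType d) :=
  Measurable.on (zt_seq R Z).

Section zt_seq.
Context {R : realType} {d} {Z : measurableType d}.

Lemma measurable_zt_seqE :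
  @measurable _ (zt_seq R Z) = <<s @zt_cylinders R d Z >>.
Proof. by []. Qed.

Lemma zt_cylindersI : setI_closed (@zt_cylinders R d Z).
Proof.
move=> _ _ [n [A [B [mA mB ->]]]] [m [A' [B' [mA' mB' ->]]]].
exists (maxn n m).
exists (fun i => (if (i < n)%N then A i else setT) `&` (if (i < m)%N then A' i else setT)).
exists (fun i => (if (i < n)%N then B i else setT) `&` (if (i < m)%N then B' i else setT)).
split.
- by move=> i; apply: measurableI; case: ifP.
- by move=> i; apply: measurableI; case: ifP.
apply/seteqP; split => [s [/= h h'] i _|s /= h].
  have {}h := h i; have {}h' := h' i.
  by split; split; case: ifP => // im; [case: (h im)|case: (h' im)|case: (h im)|case: (h' im)].
split=> i im.
  have := h i; rewrite leq_max im/= => /(_ isT)[[? _] [? _]].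
  by split.
have := h i; rewrite leq_max im orbT/= => /(_ isT)[[_ ?] [_ ?]].
by split.
Qed.

(** Padding with [setT] makes a cylinder long enough to reach both halves of a split spacing, at the
    indices [k] and [k.+1]. *)
Lemma zt_cylinders_widen (S : set (nat -> Z * R)) (m : nat) : zt_cylinders S ->
  exists (n : nat) (A : nat -> set Z) (B : nat -> set R),
    [/\ (m <= n)%N, forall i, measurable (A i), forall i, measurable (B i) &
      S = [set s | forall i, (i < n)%N -> A i (s i).1 /\ B i (s i).2]].
Proof.
move=> [n [A [B [mA mB ->]]]]; exists (maxn n m).
exists (fun i => if (i < n)%N then A i else setT).
exists (fun i => if (i < n)%N then B i else setT).
split; [exact: leq_maxr|by move=> i; case: ifP|by move=> i; case: ifP|].
apply/seteqP; split => s /= h i im.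
  by split; case: ifP => // /h[].
by have := h i; rewrite leq_max im => /(_ isT).
Qed.

Lemma measurable_fun_zt_seq d' (T : measurableType d') (f : T -> zt_seq R Z) :
  (forall i, measurable_fun setT (fun x => (f x i).1)) ->
  (forall i, measurable_fun setT (fun x => (f x i).2)) ->
  measurable_fun setT f.
Proof.
move=> mf1 mf2; apply: (measurability _ measurable_zt_seqE).
move=> _ [_ [n [A [B [mA mB ->]]]] <-]; rewrite setTI.
rewrite (_ : _ @^-1` _ = \bigcap_(i in `I_n)
  ((fun x => (f x i).1) @^-1` A i `&` (fun x => (f x i).2) @^-1` B i)).
  apply: bigcap_measurableType => i _; apply: measurableI.
    by rewrite -[X in measurable X]setTI; exact: mf1.
  by rewrite -[X in measurable X]setTI; exact: mf2.
by apply/seteqP; split => x.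
Qed.

Lemma measurable_zt_fst i : measurable_fun setT (fun s : zt_seq R Z => (s i).1).
Proof.
move=> _ A mA; rewrite setTI; apply: sub_sigma_algebra.
exists i.+1, (fun j => if j == i then A else setT), (fun=> setT).
split=> //; first by move=> j; case: ifP.
apply/seteqP; split => s /= h.
  by move=> j _; split => //; case: ifPn => // /eqP ->.
by have [] := h i (ltnSn i); rewrite eqxx.
Qed.

Lemma measurable_zt_snd i : measurable_fun setT (fun s : zt_seq R Z => (s i).2).
Proof.
move=> _ A mA; rewrite setTI; apply: sub_sigma_algebra.
exists i.+1, (fun=> setT), (fun j => if j == i then A else setT).
split=> //; first by move=> j; case: ifP.
apply/seteqP; split => s /= h.
  by move=> j _; split => //; case: ifPn => // /eqP ->.
by have [_] := h i (ltnSn i); rewrite eqxx.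
Qed.

(* Inserting a point with mark [z] at distance [u] into the [k]-th spacing splits
   [(s k).2] into [u] and [(s k).2 - u]. *)
Definition zt_insert (k : nat) (s : zt_seq R Z) (z : Z) (u : R) : zt_seq R Z :=
  fun j => if (j < k)%N then s j else if j == k then (z, u) else
    if j == k.+1 then ((s k).1, (s k).2 - u) else s j.-1.

Lemma zt_insert_eq k s z u : zt_insert k s z u k = (z, u).
Proof. by rewrite /zt_insert ltnn eqxx. Qed.

(** [bump k] skips [k], hence sends the index of an old point to its index after the insertion. Only
    the spacing that was split changes. *)
Lemma zt_insert_bump k s z u j : zt_insert k s z u (bump k j) =
  if j == k then ((s k).1, (s k).2 - u) else s j.
Proof.
rewrite /zt_insert /bump; case: (ltngtP j k) => [jk|kj|->].
- by rewrite add0n jk.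
- by rewrite add1n ltnNge ltnW ?leqW// gtn_eqF ?leqW//= eqSS gtn_eqF.
- by rewrite add1n ltnNge leqnSn/= gtn_eqF// eqxx.
Qed.

End zt_seq.

(** * Inserting a point preserves the law *)

(* Bundled, because no sigma-finite structure is inferred for [Pr \x Q], which
   Tonelli's theorem for [(Pr \x Q) \x mu] requires. *)
Definition prod_prob {R : realType} {d dO : measure_display} {Z : measurableType d}
  {Omega : measurableType dO} (Pr : probability Omega R) (Q : probability Z R) :
    probability (Omega * Z)%type R :=
  lebesgue_integral_fubini_product_measure1__canonical__probability_measure_Probability Pr Q.

Lemma integral_prod_prob {R : realType} {d dO : measure_display} {Z : measurableType d}
  {Omega : measurableType dO} (Pr : probability Omega R) (Q : probability Z R)
  (f : Omega * Z -> \bar R) : measurable_fun setT f -> (forall p, 0 <= f p)%E ->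
  (\int[prod_prob Pr Q]_p f p = \int[Pr]_w \int[Q]_z f (w, z))%E.
Proof. by move=> mf f0; exact: (@fubini_tonelli1 _ _ _ _ _ Pr Q f mf f0). Qed.

(** The variable [u] is integrated last because the sections at fixed [u] are rectangles in the
    application to cylinders. *)
Lemma product_lebesgueE {R : realType} d (T : measurableType d)
    (m : probability T R) (C : set (T * measurableTypeR R)) : measurable C ->
  ((m \x (@lebesgue_measure R)) C =
   \int[lebesgue_measure]_u \int[m]_p (\1_C (p, u))%:E)%E.
Proof.
move=> mC; rewrite -[X in (_ \x _)%E X]setIT -[LHS]integral_indic//.
apply: (fubini_tonelli2 (fun p => (\1_C p)%:E)).
  by apply/measurable_EFinP; exact: measurable_indic.
by move=> p; rewrite lee_fin.
Qed.

Section insertion_law.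
Context {R : realType} {d dO : measure_display} {Z : measurableType d}
  {Omega : measurableType dO} (Pr : probability Omega R) (Q : probability Z R)
  (Zs : nat -> Omega -> Z) (E : nat -> Omega -> R).
Hypothesis src : ppr_source Pr Q Zs E.
Local Open Scope ereal_scope.
Local Notation mu := (@lebesgue_measure R).

Definition zt_source (w : Omega) : zt_seq R Z := fun i => (Zs i w, E i w).

Lemma measurable_zt_source : measurable_fun setT zt_source.
Proof. by case: src => mZ mE _; exact: measurable_fun_zt_seq. Qed.

Let ins k (p : Omega * Z * measurableTypeR R) : zt_seq R Z :=
  zt_insert k (zt_source p.1.1) p.1.2 p.2.

Let mE k : measurable_fun setT
  (fun p : Omega * Z * measurableTypeR R => E k p.1.1).
Proof.
case: src => _ mE _; apply: measurableT_comp (mE k) _.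
exact: measurableT_comp.
Qed.

Let mZs k : measurable_fun setT
  (fun p : Omega * Z * measurableTypeR R => Zs k p.1.1).
Proof.
case: src => mZ _ _; apply: measurableT_comp (mZ k) _.
exact: measurableT_comp.
Qed.

Let msnd : measurable_fun setT
  (fun p : Omega * Z * measurableTypeR R => p.2 : R).
Proof. exact: measurable_snd. Qed.

Lemma measurable_zt_insert k : measurable_fun setT (ins k).
Proof.
apply: measurable_fun_zt_seq => i; rewrite /ins /zt_insert/=;
    case: (i < k)%N; case: (i == k); case: (i == k.+1).
all: try exact: mZs.
all: try exact: mE.
all: try exact: msnd.
all: try exact: measurable_funB (mE _) msnd.
all: exact: (measurableT_comp measurable_snd measurable_fst).
Qed.

(** The new point lands in the [k]-th spacing. The half-open range lets consecutive spacings tile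
    the half-line without overlap. *)
Let D k := [set p : Omega * Z * measurableTypeR R | (0 < p.2 <= E k p.1.1)%R].

Let mD k : measurable (D k).
Proof.
rewrite -[X in measurable X]setTI.
have : measurable_fun setT
    (fun p : Omega * Z * measurableTypeR R => (0 < p.2 <= E k p.1.1)%R).
  apply: measurable_and.
    exact: (measurable_fun_ltr (measurable_cst _) msnd).
  exact: (measurable_fun_ler msnd (mE k)).
by move=> /(_ measurableT [set true]); apply.
Qed.

Let expP (B : set R) : measurable B ->
  (fine (exponential_prob 1 B))%:E = exponential_prob 1 B.
Proof.
move=> mB; rewrite fineK//.
exact: (fin_num_measure
  (exponential_distribution_exponential_prob__canonical__probability_measure_Probability
     (ltr01 : (0 < 1 :> R)%R))).
Qed.

(** At fixed [u] the insertion pulls a cylinder back to a product event. By memorylessness the split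
    spacing contributes [e^-u] times the probability of [B k.+1], and integrating [e^-u] over [u] in
    [B k] supplies the missing factor. *)
Let law_cylinder k (S : set (zt_seq R Z)) : zt_cylinders S ->
  image_measure Pr measurable_zt_source S =
  image_measure (mrestr (prod_prob Pr Q \x mu) (mD k)) (measurable_zt_insert k) S.
Proof.
move=> /(zt_cylinders_widen k.+2)[n [A [B [kn mA mB ->]]]].
case: n kn => // n kn.
have [mZs0 mE0 srcE] := src.
set S0 := [set s | _].
have mS0 : measurable (S0 : set (zt_seq R Z)).
  by apply: sub_sigma_algebra; exists n.+1, A, B.
rewrite /= /pushforward /mrestr.
rewrite (_ : zt_source @^-1` _ =
  \bigcap_(i in `I_n.+1) (Zs i @^-1` A i `&` E i @^-1` B i)); last first.
  by apply/seteqP; split => w.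
(* The factor at index [k], that of the inserted point, is split off; the remaining ones are indexed
   through [bump k]. *)
rewrite srcE// (bigD1_ord (Ordinal (ltnW kn)))//=.
set C := (X in (_ \x _) X).
have mC : measurable C.
  apply: measurableI (mD k).
  by rewrite -[X in measurable X]setTI; exact: measurable_zt_insert.
pose A' i := A (bump k i).
(* The old [k]-th spacing must be at least [u], and what remains of it must satisfy the constraint
   now sitting at [k.+1]. *)
pose B' u i := if i == k then [set e | (u <= e)%R /\ B k.+1 (e - u)%R] else B (bump k i).
have mB' u i : measurable (B' u i).
  rewrite /B'; case: ifP => // _.
  have m1 : measurable_fun setT (fun e : R => e - u)%R by exact: measurable_funB.
  have := measurableI _ _ (measurable_itv `[u, +oo[) (m1 measurableT _ (mB k.+1)).
  congr measurable; apply/seteqP; split => e /=; rewrite in_itv/= andbT.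
    by move=> [? []].
  by move=> [].
pose W u := \bigcap_(i in `I_n) (Zs i @^-1` A' i `&` E i @^-1` B' u i).
have mW u : measurable (W u).
  apply: bigcap_measurableType => i _; apply: measurableI.
    by rewrite -[X in measurable X]setTI; apply: mZs0 => //; exact: mA.
  by rewrite -[X in measurable X]setTI; apply: mE0 => //; exact: mB'.
have CE p u : C (p, u) <-> [/\ (0 < u)%R, B k u, A k p.2 & W u p.1].
  rewrite /C /D /ins /S0; split=> /=.
    move=> [h /andP[u0 uE]].
    have := h k (ltnW kn); rewrite zt_insert_eq/= => -[Az Bu].
    split=> // i /= iltn; have := h (bump k i).
    rewrite zt_insert_bump /A' /B'.
    have -> : (bump k i < n.+1)%N.
      by rewrite /bump; case: (k <= i)%N; rewrite ?add1n ?add0n// ltnS// ltnW.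
    move=> /(_ isT); case: eqP => [->|//].
    by rewrite /bump leqnn add1n/= => -[].
  move=> [u0 Bu Az Wu]; split; last first.
    have [_ ] := Wu k kn; rewrite /B' /= eqxx => -[+ _].
    by rewrite u0 => ->.
  move=> i iltn; have [->|ik] := eqVneq i k; first by rewrite zt_insert_eq.
  have ibump : i = bump k (unbump k i) by rewrite unbumpK.
  rewrite ibump zt_insert_bump; have [] := Wu (unbump k i).
    move: iltn ik kn; rewrite /= /unbump !ltnS.
    case: (ltngtP k i) => //= ki; rewrite ?subn1 ?subn0.
      by case: i ki {ibump}.
    by move=> _ _; exact: ltn_trans.
  rewrite /A' /B' /=; case: eqP => [->|//].
  by rewrite /bump leqnn add1n => ? [].
rewrite product_lebesgueE//.
set c := (\prod_(i < n) _)%R.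
transitivity (\int[mu]_u ((fine (Q (A k)) * (\prod_(i < n)
   (fine (Q (A' i)) * fine (exponential_prob 1 (B (bump k i))))))%:E *
  (if (0 < u)%R && (u \in B k) then (expR (- u))%:E else 0))).
  rewrite ge0_integralZl//; last 3 first.
  - apply: measurable_fun_ifT => //.
      apply: measurable_and; first exact: measurable_fun_ltr.
      exact: (measurable_mem (mB k)).
    by apply/measurable_EFinP; apply: measurableT_comp.
  - by move=> x _; case: ifP => // _; rewrite lee_fin expR_ge0.
  - rewrite lee_fin mulr_ge0 ?fine_ge0//; apply: prodr_ge0 => i _.
    by rewrite mulr_ge0 ?fine_ge0// /exponential_prob integral_ge0// => x _;
      rewrite lee_fin exponential_pdf_ge0.
  rewrite -exponential_prob_gt0E// -expP// -EFinM; congr EFin.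
  by rewrite mulrAC.
apply: eq_integral => u _; apply/esym.
case: ifPn => [/andP[u0 /set_mem Bu]|nu]; last first.
  rewrite mule0 integral0_eq// => p _; rewrite indicE.
  case: (boolP ((p, u) \in C)) => // /set_mem/CE[u0 /mem_set Bu _ _].
  by rewrite u0 Bu in nu.
rewrite (eq_integral (fun p => (\1_(W u `*` A k) p)%:E)).
  rewrite integral_indic//; last exact: measurableX.
  have PW : Pr (W u) = _ := srcE n A' (B' u) (fun i => mA _) (mB' u).
  rewrite setIT [LHS]product_measure1E// [X in X * _]PW.
  rewrite -[X in _ * X](@fineK _ (Q (A k))) ?fin_num_measure// -!EFinM; congr EFin.
  rewrite mulrC -mulrA; congr (_ * _)%R.
  have kn' : (k < n)%N by [].
  (* Only the factor at [k] depends on [u]; isolating it makes memorylessness applicable. *)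
  rewrite (bigD1 (Ordinal kn'))//= [in RHS](bigD1 (Ordinal kn'))//=.
  rewrite (eq_bigr (fun i : 'I_n => fine (Q (A' i)) *
    fine (exponential_prob 1 (B (bump k i))))%R); last first.
    move=> i ik; rewrite /B' ifF//.
    by apply/negbTE; apply: contra ik => /eqP ik; apply/eqP/val_inj.
  rewrite [in LHS]/B' eqxx exponential_prob_shift ?ltW//.
  rewrite -[exponential_prob 1 (B k.+1)]expP//= /bump leqnn add1n.
  by ring.
move=> p _; rewrite !indicE; congr ((nat_of_bool _)%:R%:E).
apply/idP/idP => /set_mem h; apply/mem_set.
  by case/CE : h => _ _ Az Ww; split.
by apply/CE; split => //; case: h.
Qed.

(** Both sides integrate [Psi] against image measures that agree on the pi-system of cylinders. The
    cylinder of length 0 is the whole space and has finite mass, so the two measures are equal. *)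
Lemma integral_zt_insert k (Psi : zt_seq R Z -> \bar R) :
  measurable_fun setT Psi -> (forall s, 0 <= Psi s) ->
  \int[Pr]_w Psi (zt_source w) =
  \int[prod_prob Pr Q \x mu]_p (if (0 < p.2 <= E k p.1.1)%R
     then Psi (zt_insert k (zt_source p.1.1) p.1.2 p.2) else 0).
Proof.
move=> mP P0.
rewrite -(ge0_integral_image_measure Pr measurable_zt_source mP P0).
transitivity (\int[image_measure (mrestr (prod_prob Pr Q \x mu) (mD k))
   (measurable_zt_insert k)]_s Psi s).
  apply: eq_measure_integral => S mS _.
  apply: (@measure_unique _ R (zt_seq R Z) (@zt_cylinders R d Z) (fun=> setT)
    measurable_zt_seqE zt_cylindersI _ _ (image_measure Pr measurable_zt_source)
    (image_measure (mrestr (prod_prob Pr Q \x mu) (mD k)) (measurable_zt_insert k))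
    (law_cylinder k) _ S mS).
  - move=> _; exists 0%N, (fun=> setT), (fun=> setT); split => //.
    by apply/seteqP; split.
  - by rewrite bigcup_const//; exists 0%N.
  - by move=> _; rewrite /= /pushforward preimage_setT probability_setT ltry.
have mPi : measurable_fun setT (fun p => Psi (ins k p)).
  exact: measurableT_comp (measurable_zt_insert k).
etransitivity; first exact:
  (ge0_integral_image_measure _ (measurable_zt_insert k) mP P0).
etransitivity; first exact:
  (ge0_integral_mrestr _ (mD k) mPi (fun p => P0 (ins k p))).
exact: (@integral_mkif _ _ _ _ (D k)
  (fun p => 0 < p.2 <= E k p.1.1)%R (fun p => Psi (ins k p))).
Qed.

End insertion_law.

(** * The Mecke equation *)

Lemma nneseries_bump {R : realType} (a : (\bar R)^nat) (k : nat) :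
  (forall j, 0 <= a j)%E ->
  (\sum_(j <oo) (if j == k then 0 else a j) = \sum_(j <oo) a (bump k j))%E.
Proof.
move=> a0; have b0 j : (0 <= (if j == k then 0 else a j))%E by case: ifP.
rewrite (nneseries_split 0%N k)//= add0n.
rewrite (nneseries_split k 1%N)//= addn1 big_nat1 eqxx add0e.
rewrite -nneseries_addn//.
rewrite [RHS](nneseries_split 0%N k)//= add0n -[in RHS]nneseries_addn//.
congr (_ + _)%E.
  apply: eq_big_nat => j /andP[_ jk].
  by rewrite ltn_eqF// /bump leqNgt jk.
apply: eq_eseriesr => j _; rewrite gtn_eqF; last by rewrite addnS ltnS leq_addl.
by rewrite /bump leq_addl add1n addnS.
Qed.

(** * Times and weight sums of the points under insertion *)

Section zt_points.
Context {R : realType} {d} {Z : measurableType d}.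
Implicit Type s : zt_seq R Z.

Definition zt_T s (k : nat) : R := \sum_(j < k.+1) (s j).2.

Lemma zt_T_insert_eq k s z u :
  zt_T (zt_insert k s z u) k = \sum_(j < k) (s j).2 + u.
Proof.
rewrite /zt_T big_ord_recr/= zt_insert_eq; congr +%R.
by apply: eq_bigr => j _; rewrite /zt_insert ltn_ord.
Qed.

(** Old points keep their times: the two pieces [u] and [(s k).2 - u] add up to the spacing they
    replace. *)
Lemma zt_T_insert_bump k s z u j :
  zt_T (zt_insert k s z u) (bump k j) = zt_T s j.
Proof.
rewrite /zt_T; case: (leqP k j) => kj; rewrite /bump.
  rewrite kj add1n.
  have kj2 : (k < j.+2)%N by rewrite ltnS leqW.
  have kj1 : (k < j.+1)%N by rewrite ltnS.
  rewrite (bigD1_ord (Ordinal kj2))//= zt_insert_eq/=.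
  rewrite (bigD1 (Ordinal kj1))//= zt_insert_bump eqxx/= addrA [u + _]addrC subrK.
  rewrite [RHS](bigD1 (Ordinal kj1))//=; congr +%R.
  apply: eq_bigr => i ik; rewrite zt_insert_bump ifF//.
  by apply/negbTE; apply: contra ik => /eqP ik; apply/eqP/val_inj.
rewrite leqNgt kj add0n; apply: eq_bigr => i _.
by rewrite /zt_insert (leq_trans (ltn_ord i)).
Qed.

Lemma measurable_zt_T k : measurable_fun setT (zt_T ^~ k).
Proof. by apply: measurable_sum => i; exact: measurable_zt_snd. Qed.

Variable h : Z * R -> R.
Hypotheses (mh : measurable_fun setT h) (h0 : forall x, 0 <= h x).

Definition zt_sum s : \bar R := (\sum_(j <oo) (h ((s j).1, zt_T s j))%:E)%E.

(** The [k]-th term is replaced by 0 instead of being subtracted from [zt_sum], which may be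
    [+oo]. *)
Definition zt_sum_but s k : \bar R :=
  (\sum_(j <oo) (if j == k then 0 else (h ((s j).1, zt_T s j))%:E))%E.

(** Leaving out the inserted point recovers the original configuration; this is why the right side
    of the Mecke equation involves the full sum. *)
Lemma zt_sum_but_insert k s z u :
  zt_sum_but (zt_insert k s z u) k = zt_sum s.
Proof.
rewrite /zt_sum_but nneseries_bump; last by move=> j; rewrite lee_fin.
apply: eq_eseriesr => j _; rewrite zt_insert_bump zt_T_insert_bump.
by case: eqP => [->|].
Qed.

Lemma measurable_zt_h k :
  measurable_fun setT (fun s => (h ((s k).1, zt_T s k))%:E).
Proof.
apply/measurable_EFinP; apply: measurableT_comp => //.
by apply: measurable_fun_pair; [exact: measurable_zt_fst|exact: measurable_zt_T].
Qed.

Lemma measurable_zt_sum : measurable_fun setT zt_sum.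
Proof.
apply: ge0_emeasurable_sum; first by move=> k x _ _; rewrite lee_fin.
by move=> k _; exact: measurable_zt_h.
Qed.

Lemma measurable_zt_sum_but k : measurable_fun setT (zt_sum_but ^~ k).
Proof.
apply: ge0_emeasurable_sum.
  by move=> j x _ _; case: ifP => // _; rewrite lee_fin.
by move=> j _; case: (j == k) => //; exact: measurable_zt_h.
Qed.

End zt_points.

Section mecke.
Context {R : realType} {d dO : measure_display} {Z : measurableType d}
  {Omega : measurableType dO} (Pr : probability Omega R) (Q : probability Z R)
  (Zs : nat -> Omega -> Z) (E : nat -> Omega -> R).
Hypothesis src : ppr_source Pr Q Zs E.
Local Open Scope ereal_scope.
Local Notation mu := (@lebesgue_measure R).
Variable h : Z * R -> R.
Hypotheses (mh : measurable_fun setT h) (h0 : forall x, (0 <= h x)%R).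
Variable G : Z * R * \bar R -> \bar R.
Hypotheses (mG : measurable_fun setT G) (G0 : forall x, 0 <= G x).

Local Notation T := (ppr_T E).
Let Tpre (k : nat) (w : Omega) : R := (\sum_(j < k) E j w)%R.
Let M (w : Omega) := zt_sum h (zt_source Zs E w).

Let TpreS k w : T k w = (Tpre k w + E k w)%R.
Proof. by rewrite /ppr_T big_ord_recr. Qed.

Let mM : measurable_fun setT M.
Proof.
by apply: measurableT_comp (measurable_zt_sum _ _) (measurable_zt_source src).
Qed.

Let mT k : measurable_fun setT (T k).
Proof. by case: src => _ mE _; exact: measurable_sum. Qed.

Let mTpre k : measurable_fun setT (Tpre k).
Proof. by case: src => _ mE _; exact: measurable_sum. Qed.

Let mGM : measurable_fun setT
  (fun p : Omega * Z * measurableTypeR R => G (p.1.2, p.2, M p.1.1)).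
Proof.
apply: measurableT_comp => //; apply: measurable_fun_pair.
  apply: measurable_fun_pair.
    exact: (measurableT_comp measurable_snd measurable_fst).
  exact: measurable_snd.
apply: measurableT_comp => //.
exact: (measurableT_comp measurable_fst measurable_fst).
Qed.

Let mGt w z :
  measurable_fun setT (fun t : measurableTypeR R => G (z, t, M w)).
Proof.
exact: (measurableT_comp mGM
  (measurable_fun_pair (measurable_cst (w, z)) (@measurable_id _ _ setT))).
Qed.

Let F k (p : Omega * Z * measurableTypeR R) :=
  if (Tpre k p.1.1 < p.2 <= T k p.1.1)%R then G (p.1.2, p.2, M p.1.1) else 0.

Let mF k : measurable_fun setT (F k).
Proof.
have mw : measurable_fun setT (fun p : Omega * Z * measurableTypeR R => p.1.1).
  exact: (measurableT_comp measurable_fst measurable_fst).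
apply: measurable_fun_ifT => //; apply: measurable_and.
  apply: measurable_fun_ltr; last exact: measurable_snd.
  exact: (measurableT_comp (mTpre k) mw).
apply: measurable_fun_ler; first exact: measurable_snd.
exact: (measurableT_comp (mT k) mw).
Qed.

Let F0 k p : 0 <= F k p.
Proof. by rewrite /F; case: ifP. Qed.

(** A point inserted at distance [u] in []0, E k]] has time [t = Tpre k + u], so after Tonelli and a
    translation [t] runs over []Tpre k, T k]]. *)
Let mecke1 k :
  \int[Pr]_w G (Zs k w, T k w, zt_sum_but h (zt_source Zs E w) k) =
  \int[prod_prob Pr Q]_p \int[mu]_t F k (p, t).
Proof.
pose Psi (s : zt_seq R Z) := G ((s k).1, zt_T s k, zt_sum_but h s k).
have mPsi : measurable_fun setT Psi.
  apply: measurableT_comp => //; apply: measurable_fun_pair.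
    apply: measurable_fun_pair; first exact: measurable_zt_fst.
    exact: measurable_zt_T.
  exact: measurable_zt_sum_but.
rewrite -[LHS]/(\int[Pr]_w Psi (zt_source Zs E w)).
rewrite (integral_zt_insert src k mPsi (fun s => G0 _)).
etransitivity.
  apply: (fubini_tonelli1 (m1 := prod_prob Pr Q) (m2 := mu)).
  - apply: measurable_fun_ifT => //; last first.
      exact: (measurableT_comp mPsi (measurable_zt_insert src k)).
    have [_ mE _] := src.
    apply: measurable_and.
      by apply: measurable_fun_ltr => //; exact: measurable_snd.
    apply: measurable_fun_ler; first exact: measurable_snd.
    apply: (measurableT_comp (mE k)).
    exact: (measurableT_comp measurable_fst measurable_fst).
  - by move=> p; case: ifP => // _; exact: G0.
apply: eq_integral => p _; rewrite /fubini_F/=.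
rewrite [RHS](ge0_integral_shift (Tpre k p.1)); last 2 first.
- exact: measurableT_comp.
- by move=> t; exact: F0.
apply: eq_integral => u _; rewrite /F/= TpreS.
rewrite [(u + _)%R]addrC ltrDl lerD2l; case: ifP => // _.
by rewrite /Psi zt_insert_eq zt_T_insert_eq zt_sum_but_insert.
Qed.

Let intF k p := \int[mu]_t F k (p, t).

Let mintF k : measurable_fun setT (intF k).
Proof. by apply: (measurable_fun_fubini_tonelli_F (F k)). Qed.

Let intF0 k p : 0 <= intF k p.
Proof. exact: integral_ge0. Qed.

Lemma mecke_spacings :
  \sum_(k <oo) \int[Pr]_w G (Zs k w, T k w, zt_sum_but h (zt_source Zs E w) k) =
  \int[Pr]_w \int[Q]_z \sum_(k <oo) intF k (w, z).
Proof.
rewrite (eq_eseriesr (fun k _ => mecke1 k)).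
rewrite -(integral_nneseries (prod_prob Pr Q) measurableT mintF
  (fun k p _ => intF0 k p)).
rewrite integral_prod_prob//.
- by apply: ge0_emeasurable_sum => [k p _ _|k _]; [exact: intF0|exact: mintF].
- by move=> p; apply: nneseries_ge0 => k _ _; exact: intF0.
Qed.

(** Nonnegative spacings make [Tpre] monotone, hence the intervals disjoint, and the integrals add
    up over their union. *)
Let spacings_union w z : (forall k, 0 <= E k w)%R ->
  \sum_(k <oo) intF k (w, z) =
  \int[mu]_(t in \bigcup_k [set` `]Tpre k w, T k w]]) G (z, t, M w).
Proof.
move=> E0.
have Tle k l : (k <= l)%N -> (Tpre k w <= Tpre l w)%R.
  move=> /subnK <-; elim: (l - k)%N => // i; rewrite addSn.
  by move=> /le_trans; apply; rewrite /Tpre big_ord_recr/= lerDl.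
rewrite ge0_integral_bigcup//; last 2 first.
- exact: measurable_funTS (mGt w z).
- apply/trivIsetP => i j _ _; wlog ij : i j / (i < j)%N.
    by move=> wl /[dup] nij; case: (ltngtP i j) => // ? _;
      [apply: wl|rewrite setIC; apply: wl; rewrite // eq_sym].
  move=> _; apply/seteqP; split => // t /=; rewrite !in_itv/= => -[/andP[_ h1] /andP[h2 _]].
  have := Tle _ _ ij; rewrite /Tpre -/(T i w) => h3.
  by move: (lt_le_trans h2 h1); rewrite ltNge h3.
apply: eq_eseriesr => k _; rewrite /intF/F/=; apply/esym.
by apply: integral_mkif => t /=; rewrite in_itv.
Qed.

(** The source fixes only the law of the spacings, so their sign is known almost surely: the
    exponential law gives negative numbers no mass. *)
Lemma spacings_ge0 : {ae Pr, forall w, forall k, (0 <= E k w)%R}.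
Proof.
apply: ae_foralln => k; have [mZ mE srcE] := src.
have mN : measurable [set w | (E k w < 0)%R].
  have : measurable_fun setT (fun w => E k w < 0)%R by exact: measurable_fun_ltr.
  by move=> /(_ measurableT [set true]); rewrite setTI; apply.
exists [set w | (E k w < 0)%R]; split => //; last first.
  by move=> w /= /negP; rewrite -ltNge.
have := srcE k.+1 (fun=> setT) (fun i => if i == k then `]-oo, 0%R[%classic else setT).
rewrite (_ : \bigcap_(i in _) _ = [set w | (E k w < 0)%R]); last first.
  apply/seteqP; split => w /= => [/(_ k (ltnSn k))[_]|wk i _].
    by rewrite /= eqxx/= in_itv.
  by split => //=; case: eqP => // ->; rewrite /= in_itv.
move=> /(_ (fun=> measurableT)) PrE.
etransitivity; first by apply: PrE => i; case: ifP.
rewrite big_ord_recr/= eqxx /exponential_prob integral0_eq ?mulr0//.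
by move=> x /=; rewrite in_itv/= => x0; rewrite lt0_exponential_pdf.
Qed.

Let mpos : measurable_fun setT (fun p : Omega * Z * measurableTypeR R =>
  if (0 < p.2)%R then G (p.1.2, p.2, M p.1.1) else 0).
Proof.
apply: measurable_fun_ifT => //.
by apply: measurable_fun_ltr => //; exact: measurable_snd.
Qed.

Let mpos1 : measurable_fun setT (fun p : Omega * Z =>
  \int[mu]_t (if (0 < t)%R then G (p.2, t, M p.1) else 0)).
Proof.
by apply: (measurable_fun_fubini_tonelli_F (m2 := mu) _ mpos) => p; case: ifP.
Qed.

Let msum : measurable_fun setT (fun p : Omega * Z => \sum_(k <oo) intF k p).
Proof. by apply: ge0_emeasurable_sum => [k p _ _|k _]; [exact: intF0|exact: mintF]. Qed.

Let pos_ge0 w z : 0 <= \int[mu]_t (if (0 < t)%R then G (z, t, M w) else 0).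
Proof. by apply: integral_ge0 => t _; case: ifP. Qed.

Let sum_ge0 p : 0 <= \sum_(k <oo) intF k p.
Proof. by apply: nneseries_ge0 => k _ _; exact: intF0. Qed.

Let posE w z : \int[mu]_t (if (0 < t)%R then G (z, t, M w) else 0) =
  \int[mu]_(t in `]0%R, +oo[) G (z, t, M w).
Proof. by apply/esym/integral_mkif => t /=; rewrite in_itv/= andbT. Qed.

(** The inequality uses only that the intervals lie in []0, +oo[]. It is therefore available before
    the points are known to be unbounded, and serves to prove that. *)
Lemma campbell_le :
  \sum_(k <oo) \int[Pr]_w G (Zs k w, T k w, zt_sum_but h (zt_source Zs E w) k) <=
  \int[Pr]_w \int[Q]_z \int[mu]_t (if (0 < t)%R then G (z, t, M w) else 0).
Proof.
rewrite mecke_spacings; apply: ae_ge0_le_integral => //.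
- by move=> w _; apply: integral_ge0.
- exact: (measurable_fun_fubini_tonelli_F (m2 := Q) _ msum sum_ge0).
- by move=> w _; apply: integral_ge0.
- by apply: (measurable_fun_fubini_tonelli_F (m2 := Q) _ mpos1) => p; exact: pos_ge0.
apply: filterS spacings_ge0 => w E0 _; apply: ge0_le_integral => //.
- exact: (measurableT_comp msum
    (measurable_fun_pair (measurable_cst w) (@measurable_id _ _ setT))).
- exact: (measurableT_comp mpos1
    (measurable_fun_pair (measurable_cst w) (@measurable_id _ _ setT))).
move=> z _; rewrite spacings_union// posE; apply: ge0_subset_integral => //.
- by apply: bigcup_measurable => k _; exact: measurable_itv.
- exact: measurable_funTS (mGt w z).
move=> t [k _] /=; rewrite !in_itv/= andbT => /andP[+ _]; apply: le_lt_trans.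
exact: sumr_ge0.
Qed.

Lemma mecke : {ae Pr, forall w, forall c : R, exists k, (c < T k w)%R} ->
  \sum_(k <oo) \int[Pr]_w G (Zs k w, T k w, zt_sum_but h (zt_source Zs E w) k) =
  \int[Pr]_w \int[Q]_z \int[mu]_t (if (0 < t)%R then G (z, t, M w) else 0).
Proof.
move=> Too; rewrite mecke_spacings; apply: ae_eq_integral => //.
- exact: (measurable_fun_fubini_tonelli_F (m2 := Q) _ msum sum_ge0).
- by apply: (measurable_fun_fubini_tonelli_F (m2 := Q) _ mpos1) => p; exact: pos_ge0.
apply: filterS2 spacings_ge0 Too => w E0 Too _; apply: eq_integral => z _.
rewrite spacings_union// posE; congr (integral _ _ _).
apply/seteqP; split => t /=; rewrite in_itv/= andbT.
  move=> [k _] /=; rewrite !in_itv/= => /andP[+ _]; apply: le_lt_trans.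
  exact: sumr_ge0.
move=> t0; have ex : exists k, (t <= T k w)%R.
  by have [k /ltW tk] := Too t; exists k.
(* The least [k] with [t <= T k] gives the interval containing [t]: its left end is 0 for the first
   index, and otherwise the preceding point, which is below [t] by minimality. *)
case: (ex_minnP ex) => -[|k] tk kmin.
  by exists 0%N => //=; rewrite in_itv/= tk andbT /Tpre big_ord0.
exists k.+1 => //=; rewrite in_itv/= tk andbT ltNge.
by apply/negP => /kmin; rewrite ltnn.
Qed.

End mecke.

(** * Expected selection weights *)

Lemma powR_cvgy0 {R : realType} (b : R) : 0 < b ->
  x `^ (- b) @[x --> +oo] --> (0 : R).
Proof.
move=> b0; apply/cvgr0Pnorm_lt => e e0; near=> x.
have e'0 : 0 < e^-1 `^ b^-1 by rewrite powR_gt0// invr_gt0.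
have xe : e^-1 `^ b^-1 < x by near: x; exact: nbhs_pinfty_gt.
have x0 : 0 < x by exact: lt_trans xe.
rewrite ger0_norm ?powR_ge0// powRN -[e]invrK ltf_pV2 ?posrE ?invr_gt0 ?powR_gt0//.
rewrite (_ : e^-1 = (e^-1 `^ b^-1) `^ b); last first.
  by rewrite -powRrM mulVf ?gt_eqF// powRr1// invr_ge0 ltW.
by apply: gt0_ltr_powR => //; rewrite nnegrE ltW.
Unshelve. all: by end_near. Qed.

(** The antiderivative is [- x^-b / b] with [b = alpha - 1]; it tends to 0 at infinity since
    [b > 0]. *)
Lemma integral_powRN_lty {R : realType} (alpha : R) : 1 < alpha ->
  (\int[lebesgue_measure]_(x in `[1%R, +oo[) (x `^ (- alpha))%:E < +oo)%E.
Proof.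
move=> a1; pose b := alpha - 1; have b0 : 0 < b by rewrite subr_gt0.
have x0 (x : R) : 1 <= x -> 0 < x by apply: lt_le_trans.
have ctn (x c : R) : 0 < x -> {for x, continuous (fun y => y `^ c)}.
  move=> x_gt0; apply: differentiable_continuous; apply/derivable1_diffP.
  by apply: derivable_powR; rewrite in_itv/= andbT.
rewrite (@ge0_continuous_FTC2y R (fun x => x `^ (- alpha))
  (fun x => - b^-1 * x `^ (- b)) 1 (- b^-1 * 0)) ?ltry//.
- by move=> x _; exact: powR_ge0.
- apply/continuous_within_itvcyP; split.
    move=> x; rewrite in_itv/= andbT => /ltW/x0; exact: ctn.
  by apply: cvg_at_right_filter; exact: ctn.
- by apply: cvgMr; exact: powR_cvgy0.
- move=> x /ltW/x0 xp; apply: derivableM => //.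
  by apply: derivable_powR; rewrite in_itv/= andbT.
- apply: cvg_at_right_filter; apply: cvgMr; exact: ctn.
- move=> x; rewrite in_itv/= andbT => /ltW/x0 xp.
  rewrite derive1E deriveM//; last first.
    by apply: derivable_powR; rewrite in_itv/= andbT.
  rewrite derive_cst scaler0 addr0 (_ : 'D_1 _ x = (- b) * x `^ (- b - 1)).
    rewrite /GRing.scale/= mulrA mulNr mulrN opprK mulVf ?mul1r ?gt_eqF//.
    by congr (_ `^ _); rewrite /b; ring.
  by have := is_derive1_powR (- b) xp => /(@derive_val _ _ _ _ _ _ _).
Qed.

(** * Convergence of nonnegative series *)

Section series_aux.
Local Open Scope ereal_scope.
Context {R : realType}.

(** Some tail of the truncated series is below 1, so each of its terms is below 1 and the truncation
    is inactive there. *)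
Lemma nneseries_min1_lty (a : nat -> R) : (forall k, 0 <= a k)%R ->
  \sum_(k <oo) (Num.min 1 (a k))%:E < +oo -> \sum_(k <oo) (a k)%:E < +oo.
Proof.
move=> a0 h.
have m0 k : 0 <= (Num.min 1 (a k))%:E by rewrite lee_fin le_min ler01 a0.
have /fine_cvgP[_ /cvgrPdist_lt/(_ _ (ltr01))[N _ tN]] :=
  nneseries_tail_cvg h (fun k _ => m0 k).
have {tN} : \sum_(N <= k <oo) (Num.min 1 (a k))%:E < 1.
  have tfin : \sum_(N <= k <oo) (Num.min 1 (a k))%:E \is a fin_num.
    rewrite ge0_fin_numE; last exact: nneseries_ge0.
    apply: le_lt_trans h; rewrite [leRHS](nneseries_split 0%N N)//= add0n leeDr//.
    exact: sume_ge0.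
  have := tN N (leqnn N); rewrite /= sub0r normrN => /(le_lt_trans (ler_norm _)).
  by rewrite -[in X in _ -> X](fineK tfin) lte_fin.
move=> tN.
have aN k : (N <= k)%N -> (Num.min 1 (a k) = a k)%R.
  move=> Nk; apply/min_idPr; rewrite leNgt; apply/negP => ak1.
  move: tN; apply/negP; rewrite -leNgt.
  have -> : 1 = (Num.min 1 (a k))%:E by rewrite min_l// ltW.
  rewrite (nneseries_split N (k - N)%N)// subnKC//.
  rewrite (nneseries_split k 1%N)//= addn1 big_nat1.
  rewrite addeCA leeDl// adde_ge0//; first exact: sume_ge0.
  exact: nneseries_ge0.
rewrite (nneseries_split 0%N N)//=; last by move=> k _; rewrite lee_fin.
rewrite lte_add_pinfty//; first by rewrite sumEFin ltry.
rewrite add0n (_ : \sum_(N <= k <oo) (a k)%:E = \sum_(N <= k <oo) (Num.min 1 (a k))%:E).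
  exact: lt_trans tN (ltry _).
apply/congr_lim/funext => n; apply: eq_big_nat => k /andP[Nk _].
by rewrite aN.
Qed.

Lemma nneseries_cst1 : \sum_(k <oo) (1 : \bar R) = +oo.
Proof.
apply/eqyP => r r0.
apply: (@le_trans _ _ (\sum_(0 <= k < (Num.bound r)) (1 : \bar R))); last first.
  exact: nneseries_lim_ge.
rewrite big_const_nat subn0.
rewrite (_ : iter _ _ _ = (Num.bound r)%:R%:E); last first.
  by elim: (Num.bound r) => // n ih; rewrite iterS ih -EFinD -natr1 addrC.
by rewrite lee_fin ltW// archi_boundP// ltW.
Qed.

Lemma ae_nneseries_lty d (T : measurableType d) (mu : {measure set T -> \bar R})
    (f : (T -> \bar R)^nat) :
  (forall k, measurable_fun setT (f k)) -> (forall k x, 0 <= f k x) ->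
  \sum_(k <oo) \int[mu]_x f k x < +oo ->
  {ae mu, forall x, \sum_(k <oo) f k x < +oo}.
Proof.
move=> mf f0; rewrite -integral_nneseries// => h.
have s0 x : 0 <= \sum_(k <oo) f k x by exact: nneseries_ge0.
have : mu.-integrable setT (fun x => \sum_(k <oo) f k x).
  apply/integrableP; split; first by apply: ge0_emeasurable_sum.
  by under eq_integral do rewrite gee0_abs//.
move=> /(integrable_ae measurableT); apply: filterS => x /(_ I).
by rewrite ge0_fin_numE.
Qed.

End series_aux.

(* [ppr_wt phi alpha (z, t)] is the weight [Ttilde^-alpha] of a point with mark
   [z] at time [t], for the density [phi]. *)
Definition ppr_wt {R : realType} {Z : Type} (phi : Z -> R) (alpha : R)
  (p : Z * R) : R := phi p.1 `^ alpha * p.2 `^ (- alpha).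

Section ppr_wt.
Context {R : realType} {d : measure_display} {Z : measurableType d}.
Variable alpha : R.
Implicit Types phi : Z -> R.
Local Notation mu := (@lebesgue_measure R).

Lemma ppr_wt_ge0 phi p : 0 <= ppr_wt phi alpha p.
Proof. by rewrite /ppr_wt mulr_ge0// powR_ge0. Qed.

Lemma measurable_ppr_wt phi : measurable_fun setT phi ->
  measurable_fun setT (ppr_wt phi alpha : Z * R -> R).
Proof.
move=> mphi; apply: measurable_funM.
  apply: (measurableT_comp (measurable_powR _)).
  exact: (measurableT_comp mphi measurable_fst).
exact: (measurableT_comp (measurable_powR _) measurable_snd).
Qed.

Lemma ppr_wt_scale phi z t : 0 < phi z -> 0 < t ->
  ppr_wt phi alpha (z, phi z * t) = t `^ (- alpha).
Proof.
move=> c0 t0; rewrite /ppr_wt/= powRM ?ltW// mulrA powRN divff ?mul1r//.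
by rewrite gt_eqF// powR_gt0.
Qed.

(* The substitution [t = phi z * u]. *)
Lemma integral_ppr_wt_scale phi z (H : R -> \bar R) : 0 < alpha -> 0 <= phi z ->
  measurable_fun setT H -> (forall x, 0 <= H x)%E -> H 0 = 0%E ->
  (\int[mu]_t (if (0 < t)%R then H (ppr_wt phi alpha (z, t)) else 0) =
   (phi z)%:E * \int[mu]_u (if (0 < u)%R then H (u `^ (- alpha))%R else 0))%E.
Proof.
move=> a0 c0 mH H0 HE.
have [cE|cN] := eqVneq (phi z) 0%R.
  rewrite cE mul0e integral0_eq// => t _.
  by case: ifP => // _; rewrite /ppr_wt/= cE powR0 ?gt_eqF// mul0r HE.
have cp : 0 < phi z by rewrite lt_neqAle eq_sym cN.
have mw : measurable_fun setT (fun t : R => ppr_wt phi alpha (z, t)).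
  exact: (measurable_funM (measurable_cst (phi z `^ alpha)) (measurable_powR _)).
rewrite (ge0_integral_scale cp); last 2 first.
- apply: measurable_fun_ifT => //; first exact: measurable_fun_ltr.
  exact: (measurableT_comp mH mw).
- by move=> t; case: ifP.
congr (_ * _)%E; apply: eq_integral => u _; rewrite pmulr_rgt0//.
by case: ifP => // u0; rewrite ppr_wt_scale.
Qed.

End ppr_wt.

(** * Expectations over the marked Poisson points *)

Section ppr_expectation.
Context {R : realType} {d dO : measure_display} {Z : measurableType d}
  {Omega : measurableType dO} (Pr : probability Omega R) (Q : probability Z R)
  (Zs : nat -> Omega -> Z) (E : nat -> Omega -> R).
Hypothesis src : ppr_source Pr Q Zs E.
Local Open Scope ereal_scope.
Local Notation mu := (@lebesgue_measure R).
Local Notation T := (ppr_T E).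

Let mZT k : measurable_fun setT (fun w => (Zs k w, T k w)).
Proof.
have [mZ mE _] := src; apply: measurable_fun_pair => //.
exact: measurable_sum.
Qed.

(** By [campbell_le] the expected number of points up to time [n] is at most [n]. If all points
    stayed below [n], their number would be infinite, so this has probability 0. *)
Lemma ppr_T_unbounded :
  {ae Pr, forall w, forall c : R, exists k, (c < T k w)%R}.
Proof.
have mT k : measurable_fun setT (T k).
  by have [_ mE _] := src; exact: measurable_sum.
have aen (n : nat) : {ae Pr, forall w, exists k, (n%:R < T k w)%R}.
  pose G (p : Z * R * \bar R) : \bar R := if (p.1.2 <= n%:R)%R then 1 else 0.
  have mG : measurable_fun setT G.
    apply: measurable_fun_ifT => //; apply: measurable_fun_ler => //.
    exact: (measurableT_comp measurable_snd measurable_fst).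
  have G0 p : 0 <= G p by rewrite /G; case: ifP.
  have := @campbell_le _ _ _ _ _ Pr Q Zs E src (fun=> 0%R) (measurable_cst _)
    (fun=> lexx _) G mG G0.
  rewrite /G/= => le.
  have mk k : measurable_fun setT (fun w => if (T k w <= n%:R)%R then 1 else 0 : \bar R).
    by apply: measurable_fun_ifT => //; exact: measurable_fun_ler.
  have := @ae_nneseries_lty R _ _ Pr
    (fun k w => if (T k w <= n%:R)%R then 1 else 0) mk.
  move=> /(_ _ _) H.
  have : {ae Pr, forall w, \sum_(k <oo) (if (T k w <= n%:R)%R then 1 else 0 : \bar R) < +oo}.
    apply: H; first by move=> k x; case: ifP.
    apply: le_lt_trans le _.
    rewrite (eq_integral (cst n%:R%:E)).
      by rewrite integral_cst//= [X in _ * X]probability_setT mule1 ltry.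
    move=> w _; rewrite (eq_integral (cst n%:R%:E)).
      by rewrite integral_cst//= [X in _ * X]probability_setT mule1.
    move=> z _.
    transitivity (\int[mu]_(t in `]0%R, n%:R]) (1 : \bar R)).
      apply/esym; etransitivity.
        apply: (@integral_mkif _ _ _ mu _ (fun t => (0 < t) && (t <= n%:R))%R).
        by move=> t /=; rewrite in_itv.
      by apply: eq_integral => t _; case: (ltP 0%R t).
    rewrite integral_cst// mul1e.
    etransitivity; first exact: lebesgue_measure_itv.
    by rewrite /= lte_fin ltr0n sube0; case: (n).
  apply: filterS => w; apply: contraPP => /forallNP hw.
  rewrite (eq_eseriesr (g := fun=> 1)); first by rewrite nneseries_cst1.
  by move=> k _; rewrite ifT// leNgt; apply/negP/hw.
have := ae_foralln aen; apply: filterS => w hw c.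
have [k kw] := hw (Num.bound `|c|); exists k.
apply: le_lt_trans kw; rewrite (le_trans (ler_norm _))// ltW//.
exact: archi_boundP.
Qed.

Variables (alpha : R) (sigma : Z -> R).
Hypotheses (alpha1 : (1 < alpha)%R) (sigma0 : forall z, (0 <= sigma z)%R)
  (msigma : measurable_fun setT sigma)
  (isigma : \int[Q]_z (sigma z)%:E < +oo).

Let M w := zt_sum (ppr_wt sigma alpha) (zt_source Zs E w).

Let alpha0 : (0 < alpha)%R. Proof. exact: lt_trans alpha1. Qed.

(** The weights can have infinite expectation, as [u^-alpha] is not integrable at 0. Truncated at 1,
    their sum has expectation at most a finite constant times the integral of [sigma], and
    truncation does not affect convergence. *)
Lemma ppr_sum_lty : {ae Pr, forall w, M w < +oo}.
Proof.
(* The inner [max] makes [H] nonnegative on all of [R], as the substitution lemma requires; on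
   weights it has no effect. *)
pose H (x : R) : \bar R := (Num.min 1 (Num.max 0 x))%:E.
have mH : measurable_fun setT H.
  apply/measurable_EFinP; apply: measurable_minr => //; exact: measurable_maxr.
have H0 x : 0 <= H x by rewrite lee_fin le_min ler01 le_max lexx.
have HE x : (0 <= x)%R -> H x = (Num.min 1 x)%:E.
  by move=> x0; rewrite /H max_r.
have mw : measurable_fun setT (ppr_wt sigma alpha : Z * R -> R).
  exact: measurable_ppr_wt.
pose G (p : Z * R * \bar R) := H (ppr_wt sigma alpha p.1).
have mG : measurable_fun setT G.
  apply: (measurableT_comp mH); exact: (measurableT_comp mw measurable_fst).
have := @campbell_le _ _ _ _ _ Pr Q Zs E src _ mw (ppr_wt_ge0 _ _) G mG (fun p => H0 _).
rewrite /G/= => le.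
have : {ae Pr, forall w, \sum_(k <oo) H (ppr_wt sigma alpha (Zs k w, T k w)) < +oo}.
  apply: ae_nneseries_lty => //.
    move=> k; apply: (measurableT_comp mH); exact: (measurableT_comp mw (mZT k)).
  apply: le_lt_trans le _.
  set c := \int[mu]_u (if (0 < u)%R then H (u `^ (- alpha))%R else 0).
  have c0 : 0 <= c by apply: integral_ge0 => u _; case: ifP.
  have coo : c < +oo.
    have mp : measurable_fun setT (fun u : R => (u `^ (- alpha))%:E).
      by apply/measurable_EFinP; exact: measurable_powR.
    (* Splitting at 1: the bound 1 serves on []0, 1]] and the bound [u^-alpha] beyond. *)
    apply: (@le_lt_trans _ _ (\int[mu]_u ((if (0 < u <= 1)%R then 1 else 0) +
       (if (1 <= u)%R then (u `^ (- alpha))%:E else 0)))).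
      apply: ge0_le_integral => //.
      - by move=> u _; case: ifP.
      - apply: measurable_fun_ifT => //; first exact: measurable_fun_ltr.
        apply: (measurableT_comp mH); exact: measurable_powR.
      - apply: emeasurable_funD.
          apply: measurable_fun_ifT => //; apply: measurable_and.
            exact: measurable_fun_ltr.
          exact: measurable_fun_ler.
        by apply: measurable_fun_ifT => //; exact: measurable_fun_ler.
      - move=> u _; case: (ltP 0%R u) => u0 /=; last first.
          by rewrite add0e; case: ifP => // _; rewrite lee_fin powR_ge0.
        rewrite HE ?powR_ge0//; case: (leP u 1%R) => u1.
          apply: (@le_trans _ _ (1 + 0)); last first.
            by rewrite leeD2l//; case: ifP => // _; rewrite lee_fin powR_ge0.
          by rewrite adde0 lee_fin ge_min lexx.
        by rewrite (ltW u1) add0e lee_fin ge_min lexx orbT.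
    rewrite ge0_integralD//; last 4 first.
    - by move=> u _; case: ifP.
    - apply: measurable_fun_ifT => //; apply: measurable_and.
        exact: measurable_fun_ltr.
      exact: measurable_fun_ler.
    - by move=> u _; case: ifP => // _; rewrite lee_fin powR_ge0.
    - by apply: measurable_fun_ifT => //; exact: measurable_fun_ler.
    rewrite lte_add_pinfty//.
      rewrite -(@integral_mkif _ _ _ mu `]0%R, 1%R] (fun u => 0 < u <= 1)%R); last first.
        by move=> u /=; rewrite in_itv.
      rewrite integral_cst//= mul1e [X in X < _]lebesgue_measure_itv/=.
      by rewrite lte_fin ltr01 sube0 ltry.
    rewrite -(@integral_mkif _ _ _ mu `[1%R, +oo[ (fun u => 1 <= u)%R); last first.
      by move=> u /=; rewrite in_itv/= andbT.
    exact: integral_powRN_lty.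
  rewrite (eq_integral (cst (c * \int[Q]_z (sigma z)%:E))).
    rewrite integral_cst//= [X in _ * X]probability_setT mule1.
    rewrite lte_mul_pinfty// ge0_fin_numE//.
  move=> w _; rewrite -ge0_integralZl//; last 2 first.
  - exact/measurable_EFinP.
  - by move=> z _; rewrite lee_fin.
  apply: eq_integral => z _.
  rewrite (integral_ppr_wt_scale alpha0 (sigma0 z) mH H0) 1?muleC//.
  by rewrite HE// min_r.
apply: filterS => w hw; apply: nneseries_min1_lty; first by move=> k; exact: ppr_wt_ge0.
by move: hw; congr (_ < _); apply: eq_eseriesr => k _; rewrite HE// ppr_wt_ge0.
Qed.

Let Phi (m : \bar R) := \int[mu]_u (if (0 < u)%R then
  (u `^ (- alpha))%:E / ((u `^ (- alpha))%:E + m) else 0).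

Let ratio (p : R * \bar R) := p.1%:E / (p.1%:E + p.2).

Let mratio : measurable_fun setT ratio.
Proof.
apply: emeasurable_funM.
  by apply/measurable_EFinP; exact: measurable_fst.
apply: measurable_inve; apply: emeasurable_funD => //.
by apply/measurable_EFinP; exact: measurable_fst.
Qed.

Let ratio0 x m : (0 <= x)%R -> 0 <= m -> 0 <= ratio (x, m).
Proof.
by move=> x0 m0; rewrite /ratio mule_ge0 ?lee_fin// inve_ge0 adde_ge0// lee_fin.
Qed.

Let M0 w : 0 <= M w.
Proof. by apply: nneseries_ge0 => k _ _; rewrite lee_fin ppr_wt_ge0. Qed.

Let Phi0 m : 0 <= m -> 0 <= Phi m.
Proof.
move=> m0; apply: integral_ge0 => u _; case: ifP => // _.
by apply: (@ratio0 (u `^ (- alpha))%R m) => //; exact: powR_ge0.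
Qed.

(** [C] is the expectation of [Phi] at the total [sigma]-weight. The substitution [t = tau z * u]
    removes [tau] from the ratio and leaves the factor [tau z], so one [C] serves every [tau]. *)
Lemma ppr_expectation : exists2 C : \bar R, 0 <= C &
  forall tau : Z -> R, (forall z, (0 <= tau z)%R) -> measurable_fun setT tau ->
  \sum_(k <oo) \int[Pr]_w ((ppr_wt tau alpha (Zs k w, T k w))%:E /
     ((ppr_wt tau alpha (Zs k w, T k w))%:E +
      zt_sum_but (ppr_wt sigma alpha) (zt_source Zs E w) k)) =
  C * \int[Q]_z (tau z)%:E.
Proof.
exists (\int[Pr]_w Phi (M w)); first by apply: integral_ge0 => w _; exact: Phi0.
move=> tau tau0 mtau.
have mwt : measurable_fun setT (ppr_wt tau alpha : Z * R -> R).
  exact: measurable_ppr_wt.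
have mw : measurable_fun setT (ppr_wt sigma alpha : Z * R -> R).
  exact: measurable_ppr_wt.
(* The [max] with 0 provides nonnegativity at every argument, which [mecke] asks for; the sums
   plugged in are nonnegative anyway. *)
pose G (p : Z * R * \bar R) :=
  ratio (ppr_wt tau alpha p.1, Order.max 0 p.2).
have mG : measurable_fun setT G.
  apply: (measurableT_comp mratio); apply: measurable_fun_pair.
    exact: (measurableT_comp mwt measurable_fst).
  by apply: measurable_maxe => //; exact: measurable_snd.
have G0 p : 0 <= G p by rewrite ratio0 ?ppr_wt_ge0// le_max lexx.
have mPhiM : measurable_fun setT (fun w => Phi (M w)).
  pose K (p : Omega * measurableTypeR R) := if (0 < p.2)%R then
    ratio (p.2 `^ (- alpha), M p.1)%R else 0.
  have mK : measurable_fun setT K.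
    apply: measurable_fun_ifT => //.
      by apply: measurable_fun_ltr => //; exact: measurable_snd.
    apply: (measurableT_comp mratio); apply: measurable_fun_pair.
      exact: (measurableT_comp (measurable_powR _) measurable_snd).
    apply: (measurableT_comp _ measurable_fst).
    apply: (measurableT_comp _ (measurable_zt_source src)).
    exact: measurable_zt_sum (ppr_wt_ge0 _ _).
  apply: (measurable_fun_fubini_tonelli_F (m2 := mu) _ mK) => p.
  by rewrite /K; case: ifP => // _; rewrite ratio0 ?powR_ge0.
transitivity (\sum_(k <oo) \int[Pr]_w G (Zs k w, T k w,
    zt_sum_but (ppr_wt sigma alpha) (zt_source Zs E w) k)).
  apply: eq_eseriesr => k _; apply: eq_integral => w _.
  rewrite /G /ratio/= max_r//; apply: nneseries_ge0 => j _ _.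
  by case: ifP => // _; rewrite lee_fin ppr_wt_ge0.
rewrite (mecke src mw (ppr_wt_ge0 _ _) mG G0 ppr_T_unbounded).
rewrite -ge0_integralZr//; last 2 first.
- by move=> w _; exact: Phi0.
- by apply: integral_ge0 => z _; rewrite lee_fin.
apply: eq_integral => w _.
rewrite -ge0_integralZl//; last 3 first.
- exact/measurable_EFinP.
- by move=> z _; rewrite lee_fin.
- exact: Phi0.
apply: eq_integral => z _; rewrite /G/= -/(M w) max_r// muleC.
have mratioM : measurable_fun setT (fun x : R => ratio (Num.max 0 x, M w)%R).
  apply: (measurableT_comp mratio); apply: measurable_fun_pair => //.
  exact: measurable_maxr.
transitivity (\int[mu]_t (if (0 < t)%R then
    ratio (Num.max 0 (ppr_wt tau alpha (z, t)), M w)%R else 0)).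
  by apply: eq_integral => t _; rewrite max_r// ppr_wt_ge0.
rewrite (integral_ppr_wt_scale alpha0 (tau0 z) mratioM); last 2 first.
- by move=> x; rewrite ratio0// le_max lexx.
- by rewrite /ratio/= maxxx mul0e.
congr (_ * _); apply: eq_integral => u _.
by case: ifP => // _; rewrite /ratio/= max_r ?powR_ge0.
Qed.

End ppr_expectation.

(** * Comparing selection probabilities *)

Section pointwise.
Local Open Scope ereal_scope.
Context {R : realType}.
Implicit Types (x y c : R) (s : \bar R).

(** For finite sums, cross-multiplication leaves [x * r <= y * r']. The case [x = 0] is separate
    because the denominator may vanish, and [s' = +oo] makes the left side 0. *)
Lemma le_ratio x y s s' : (0 <= x)%R -> (x <= y)%R -> 0 <= s -> s <= s' ->
  x%:E / (x%:E + s') <= y%:E / (y%:E + s).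
Proof.
move=> x0 xy s0 ss'.
have y0 := le_trans x0 xy.
have RHS0 : 0 <= y%:E / (y%:E + s).
  by rewrite mule_ge0 ?lee_fin// inve_ge0 adde_ge0// lee_fin.
have [->|xN] := eqVneq x 0%R; first by rewrite mul0e.
have {xN}xp : (0 < x)%R by rewrite lt_neqAle eq_sym xN.
have yp := lt_le_trans xp xy.
case: s' ss' => [r'| |] ss'.
- case: s s0 ss' RHS0 => [r| |]// s0 ss' _; rewrite !lee_fin in s0 ss'.
  have xr : (0 < x + r')%R by rewrite ltr_wpDr// (le_trans s0).
  have yr : (0 < y + r)%R by rewrite ltr_wpDr.
  rewrite -!EFinD !inver !gt_eqF// -!EFinM lee_fin ler_pdivrMr//.
  rewrite mulrAC ler_pdivlMr//.
  have : (x * r <= y * r')%R by rewrite ler_pM.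
  by rewrite !mulrDr [(y * x)%R]mulrC; lra.
- by rewrite addey// invey mule0.
- by have := le_trans s0 ss'.
Qed.

(** One factor [c] pays for the numerator and one for the denominator. If [s = +oo] the left side is
    0; otherwise [s'] is finite too. *)
Lemma le_ratio_scale x y c s s' : (0 <= x)%R -> (0 < c)%R -> (x <= c * y)%R ->
  x%:E <= s -> y%:E <= s' -> s' <= c%:E * s ->
  x%:E / s <= (c * c)%:E * (y%:E / s').
Proof.
move=> x0 c0 xy xs ys s's.
have y0 : (0 <= y)%R by rewrite -(pmulr_rge0 _ c0) (le_trans x0).
have RHS0 : 0 <= (c * c)%:E * (y%:E / s').
  apply: mule_ge0; first by rewrite lee_fin mulr_ge0 ?ltW.
  apply: mule_ge0; first by rewrite lee_fin.
  by rewrite inve_ge0; apply: le_trans ys; rewrite lee_fin.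
have [->|xN] := eqVneq x 0%R; first by rewrite mul0e.
have {xN}xp : (0 < x)%R by rewrite lt_neqAle eq_sym xN.
have yp : (0 < y)%R by rewrite -(pmulr_rgt0 _ c0) (lt_le_trans xp).
case: s xs s's => [r| |]// xs s's; last first.
  by rewrite invey mule0.
case: s' ys s's RHS0 => [r'| |]// ys s's _.
rewrite lee_fin in xs; rewrite lee_fin in ys; rewrite -EFinM lee_fin in s's.
have rp := lt_le_trans xp xs; have r'p := lt_le_trans yp ys.
rewrite !inver !gt_eqF// -!EFinM lee_fin ler_pdivrMr//.
rewrite mulrA mulrAC ler_pdivlMr//.
have : (x * r' <= (c * y) * (c * r))%R by rewrite ler_pM// ltW.
by move/le_trans; apply; rewrite le_eqVlt; apply/orP; left; apply/eqP; ring.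
Qed.

Section normalized.
Variable a : nat -> R.
Hypothesis a0 : forall k, (0 <= a k)%R.
Let A := \sum_(k <oo) (a k)%:E.

Let ae0 k : 0 <= (a k)%:E. Proof. by rewrite lee_fin. Qed.

Lemma le_nneseries_term k : (a k)%:E <= A.
Proof.
rewrite /A (@nneseriesD1 R (fun k => (a k)%:E) k xpredT)// leeDl//.
by apply: nneseries_ge0.
Qed.

Let A0 : 0 <= A. Proof. exact: nneseries_ge0. Qed.

Lemma nneseries_normalized_eq0 : A = 0 -> \sum_(k <oo) ((a k)%:E / A) = 0.
Proof.
move=> AE; rewrite eseries0// => k _ _.
have /eqP -> : (a k)%:E == 0 by rewrite eq_le ae0 andbT -AE le_nneseries_term.
by rewrite mul0e.
Qed.

Lemma nneseries_normalized_eq1 : A != 0 -> A < +oo ->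
  \sum_(k <oo) ((a k)%:E / A) = 1.
Proof.
move=> AN Aoo.
have Afin : A \is a fin_num by rewrite ge0_fin_numE.
have rN : fine A != 0%R by rewrite -eqe fineK.
have AVE : A^-1 = (fine A)^-1%:E by rewrite -[in LHS](fineK Afin) inver ifF//; apply/negbTE.
rewrite AVE; under eq_eseriesr do rewrite muleC.
by rewrite nneseriesZl// -/A -[X in _ * X](fineK Afin) -EFinM mulVf.
Qed.

(** The normalized terms add up to 1 except when the total is 0 or [+oo]; in both cases every term
    is 0 by the conventions for the inverse. *)
Lemma nneseries_normalized_le1 : \sum_(k <oo) ((a k)%:E / A) <= 1.
Proof.
have [AE|AN] := eqVneq A 0; first by rewrite nneseries_normalized_eq0.
have [Aoo|] := ltP A +oo; first by rewrite nneseries_normalized_eq1.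
rewrite leye_eq => /eqP ->.
by rewrite eseries0// => k _ _; rewrite invey mule0.
Qed.

End normalized.

(* The ratio [n k / (n k + but k)] is below both normalized weights at [k], so it
   can be charged to [b] when [k] is selected by [S] and to [a] otherwise. *)
Lemma le_selection (a b m n : nat -> R) (S : nat -> bool) :
  (forall k, 0 <= n k)%R ->
  (forall k, n k <= a k <= m k)%R -> (forall k, n k <= b k <= m k)%R ->
  let but k := \sum_(j <oo) (if j == k then 0 else (m j)%:E) in
  \sum_(k <oo) (m k)%:E < +oo ->
  \sum_(k <oo) (((S k)%:R : R)%:E * (a k)%:E / \sum_(j <oo) (a j)%:E) +
    \sum_(k <oo) ((n k)%:E / ((n k)%:E + but k)) <=
  \sum_(k <oo) (((S k)%:R : R)%:E * (b k)%:E / \sum_(j <oo) (b j)%:E) +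
    \sum_(k <oo) ((m k)%:E / ((m k)%:E + but k)).
Proof.
move=> n0 nam nbm but moo.
have a0 k : (0 <= a k)%R by have /andP[+ _] := nam k; exact: le_trans.
have b0 k : (0 <= b k)%R by have /andP[+ _] := nbm k; exact: le_trans.
have m0 k : (0 <= m k)%R by have /andP[_ +] := nam k; exact: le_trans.
have sumE (u : nat -> R) k : (forall j, 0 <= u j)%R ->
    \sum_(j <oo) (u j)%:E = (u k)%:E + \sum_(j <oo) (if j == k then 0 else (u j)%:E).
  move=> u0; rewrite (@nneseriesD1 R (fun k => (u k)%:E) k xpredT)//; last first.
    by move=> j _; rewrite lee_fin.
  congr +%E; rewrite eseries_mkcond; apply: eq_eseriesr => j _ /=.
  by case: eqP.
have but_ge0 (u : nat -> R) k : (forall j, 0 <= u j)%R ->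
    0 <= \sum_(j <oo) (if j == k then 0 else (u j)%:E).
  by move=> u0; apply: nneseries_ge0 => j _ _; case: ifP => // _; rewrite lee_fin.
have leq_ratio (u : nat -> R) k : (forall j, n j <= u j <= m j)%R ->
    (n k)%:E / ((n k)%:E + but k) <= (u k)%:E / \sum_(j <oo) (u j)%:E.
  move=> num; have u0 j : (0 <= u j)%R by have /andP[+ _] := num j; exact: le_trans.
  rewrite (sumE u k)//; apply: le_ratio => //.
  - by have /andP[] := num k.
  - exact: but_ge0.
  - apply: lee_nneseries => j.
      by move=> _ _; case: ifP => // _; rewrite lee_fin.
    by move=> _; case: ifP => // _; rewrite lee_fin; have /andP[] := num j.
have div_ge0 (u : nat -> R) k : (forall j, 0 <= u j)%R ->
    0 <= (u k)%:E / \sum_(j <oo) (u j)%:E.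
  move=> u0; rewrite mule_ge0 ?lee_fin// inve_ge0.
  by apply: nneseries_ge0 => j _ _; rewrite lee_fin.
have S0 (u : nat -> R) k : (forall j, 0 <= u j)%R ->
    0 <= ((S k)%:R : R)%:E * (u k)%:E / \sum_(j <oo) (u j)%:E.
  by move=> u0; rewrite -muleA mule_ge0 ?lee_fin// div_ge0.
have q0 k : 0 <= (n k)%:E / ((n k)%:E + but k).
  by rewrite mule_ge0 ?lee_fin// inve_ge0 adde_ge0 ?lee_fin// but_ge0.
(* For [m] itself the denominator is the full sum, so these ratios are normalized weights. *)
have -> : \sum_(k <oo) ((m k)%:E / ((m k)%:E + but k)) =
    \sum_(k <oo) ((m k)%:E / \sum_(j <oo) (m j)%:E).
  by apply: eq_eseriesr => k _; rewrite (sumE m k).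
apply: (@le_trans _ _ (\sum_(k <oo) (((S k)%:R : R)%:E * (b k)%:E / \sum_(j <oo) (b j)%:E) +
    \sum_(k <oo) ((a k)%:E / \sum_(j <oo) (a j)%:E))).
  rewrite -!nneseriesD//; try by move=> k _ _; rewrite ?S0 ?q0 ?div_ge0.
  apply: lee_nneseries; first by move=> k _ _; rewrite adde_ge0 ?S0 ?q0.
  move=> k _; case: (S k); rewrite ?mul1e ?mul0e ?add0e ?leq_ratio//.
  by rewrite addeC leeD2r// leq_ratio.
rewrite leeD2l//.
have le_am : \sum_(k <oo) (a k)%:E <= \sum_(k <oo) (m k)%:E.
  apply: lee_nneseries; first by move=> k _ _; rewrite lee_fin.
  by move=> k _; rewrite lee_fin; have /andP[] := nam k.
(* It remains to compare the totals of the normalized [a] and [m]. Either all of [a] vanishes, or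
   [m] has a positive finite sum and its normalized total is exactly 1. *)
have [aE|aN] := eqVneq (\sum_(k <oo) (a k)%:E) 0.
  rewrite nneseries_normalized_eq0//.
  by apply: nneseries_ge0 => k _ _; exact: div_ge0.
rewrite (nneseries_normalized_eq1 m0)//; first exact: nneseries_normalized_le1.
apply: contra aN => /eqP mE; rewrite eq_le; apply/andP; split.
  by apply: (le_trans le_am); rewrite mE.
by apply: nneseries_ge0 => k _ _; rewrite lee_fin.
Qed.

End pointwise.

(** * Excess of one density over a multiple of another *)

Section density_excess.
Local Open Scope ereal_scope.
Context {R : realType} {d : measure_display} {Z : measurableType d}
  (Q P P' : probability Z R) (f g : Z -> R).
Hypotheses (g0 : forall z, (0 <= g z)%R)
  (mf : measurable_fun setT f) (mg : measurable_fun setT g)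
  (fP : forall A, measurable A -> P A = \int[Q]_(z in A) (f z)%:E)
  (gP : forall A, measurable A -> P' A = \int[Q]_(z in A) (g z)%:E).

(** The privacy inequality is tested on the set where [f] exceeds [e * g], which carries the whole
    positive part. *)
Lemma density_excess (e delta : R) : (0 <= e)%R ->
  (forall A, measurable A -> P A <= e%:E * P' A + delta%:E) ->
  \int[Q]_z (Num.max 0 (f z - e * g z))%:E <= delta%:E.
Proof.
move=> e0 PP'.
have mh : measurable_fun setT (fun z => f z - e * g z)%R.
  by apply: measurable_funB => //; exact: measurable_funM.
pose A := [set z | (0 < f z - e * g z)%R].
have mA : measurable A.
  have : measurable_fun setT (fun z => 0 < f z - e * g z)%R.
    exact: measurable_fun_ltr.
  by move=> /(_ measurableT [set true]); rewrite setTI; apply.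
have -> : \int[Q]_z (Num.max 0 (f z - e * g z))%:E =
    \int[Q]_(z in A) (f z - e * g z)%:E.
  rewrite (@integral_mkif _ _ _ Q A (fun z => 0 < f z - e * g z)%R)//.
  by apply: eq_integral => z _; case: (ltP 0%R (f z - e * g z)%R).
(* Finiteness allows this mass to be added to both sides and cancelled, instead of subtracting
   extended reals. *)
have gfin : e%:E * P' A \is a fin_num by rewrite fin_numM// fin_num_measure.
suff : e%:E * P' A + \int[Q]_(z in A) (f z - e * g z)%:E <= e%:E * P' A + delta%:E.
  by rewrite leeD2lE.
apply: le_trans (PP' _ mA).
rewrite fP// gP// -ge0_integralZl//; last 2 first.
- by apply/measurable_EFinP; exact: measurable_funTS.
- by move=> z _; rewrite lee_fin.
rewrite -ge0_integralD//; last 4 first.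
- by move=> z _; rewrite -EFinM lee_fin mulr_ge0.
- by apply: measurable_funeM; apply/measurable_EFinP; exact: measurable_funTS.
- by move=> z /ltW; rewrite lee_fin.
- by apply/measurable_EFinP; exact: measurable_funTS.
by rewrite le_eqVlt; apply/orP; left; apply/eqP; apply: eq_integral => z _;
  rewrite -EFinM -EFinD addrC subrK.
Qed.

End density_excess.

(** * Stability of the compressed mechanism in the density *)

Section ppr_mech.
Context {R : realType} {d dO : measure_display} {Z : measurableType d}
  {Omega : measurableType dO} (Pr : probability Omega R) (Q : probability Z R)
  (Zs : nat -> Omega -> Z) (E : nat -> Omega -> R).
Hypothesis src : ppr_source Pr Q Zs E.
Variable alpha : R.
Hypothesis alpha1 : (1 < alpha)%R.
Local Open Scope ereal_scope.
Local Notation T := (ppr_T E).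
Implicit Types (phi psi rho sigma tau : Z -> R) (S : set ((nat -> Z) * nat)).

(** The sets all of whose slices pull back to events form a sigma-algebra that contains the
    generating cylinders. *)
Lemma measurable_ppr_slice (S : set ((nat -> Z) * nat)) : ppr_measurable Z S ->
  forall k, measurable [set w | S ((fun i => Zs i w), k)].
Proof.
have [mZ _ _] := src.
pose C := [set S : set ((nat -> Z) * nat) |
  forall k, measurable [set w | S ((fun i => Zs i w), k)]].
suff : ppr_measurable Z `<=` C by move=> /(_ S) h /h.
apply: smallest_sub; first split.
- move=> k; rewrite (_ : [set w | _] = set0)//.
- move=> A CA k; rewrite setTD.
  rewrite (_ : [set w | _] = ~` [set w | A ((fun i => Zs i w), k)])//.
  exact: measurableC.
- move=> F CF k.
  rewrite (_ : [set w | _] = \bigcup_n [set w | F n ((fun i => Zs i w), k)])//.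
  by apply: bigcupT_measurable => n; exact: CF.
move=> _ [n [A [k0 [mA ->]]]] k /=.
have [->|kk0] := eqVneq k k0.
  rewrite (_ : [set w | _] = \bigcap_(i in `I_n) (Zs i @^-1` A i)).
    apply: bigcap_measurableType => i _.
    by rewrite -[X in measurable X]setTI; exact: mZ.
  by apply/seteqP; split => w /= => [[_]|h]; [exact|split].
rewrite (_ : [set w | _] = set0)//.
by apply/seteqP; split => // w /= [/eqP]; rewrite (negbTE kk0).
Qed.

Local Notation wt phi k w := (ppr_wt phi alpha (Zs k w, T k w)).
(** Taking the density itself as the input makes the mechanism meaningful for truncated densities,
    which belong to no element of the input space and need not have total mass 1. *)
Local Notation mech phi S := (ppr_mech Pr Zs E (@idfun (Z -> R)) alpha phi S).
Local Notation ind S k w := (((fun i => Zs i w), k) \in S).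

Lemma ppr_mechE phi S : mech phi S = \int[Pr]_w
  \sum_(k <oo) (((ind S k w)%:R : R)%:E * (wt phi k w)%:E /
     \sum_(i <oo) (wt phi i w)%:E).
Proof. by []. Qed.

Let mwt phi k : measurable_fun setT phi ->
  measurable_fun setT (fun w => (wt phi k w)%:E).
Proof.
have [mZ mE _] := src; move=> mphi; apply/measurable_EFinP.
apply: (measurableT_comp (measurable_ppr_wt alpha mphi)).
by apply: measurable_fun_pair => //; exact: measurable_sum.
Qed.

Let msum phi : measurable_fun setT phi ->
  measurable_fun setT (fun w => \sum_(i <oo) (wt phi i w)%:E).
Proof.
move=> mphi; apply: ge0_emeasurable_sum => [k w _ _|k _]; last exact: mwt.
by rewrite lee_fin ppr_wt_ge0.
Qed.

Let sum_ge0 phi w : 0 <= \sum_(i <oo) (wt phi i w)%:E.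
Proof. by apply: nneseries_ge0 => k _ _; rewrite lee_fin ppr_wt_ge0. Qed.

Let term_ge0 phi S k w : 0 <= ((ind S k w)%:R : R)%:E * (wt phi k w)%:E /
     \sum_(i <oo) (wt phi i w)%:E.
Proof.
by rewrite !mule_ge0 ?inve_ge0 ?lee_fin ?ppr_wt_ge0.
Qed.

Let mmech phi S : measurable_fun setT phi -> ppr_measurable Z S ->
  measurable_fun setT (fun w =>
  \sum_(k <oo) (((ind S k w)%:R : R)%:E * (wt phi k w)%:E /
     \sum_(i <oo) (wt phi i w)%:E)).
Proof.
move=> mphi mS; apply: ge0_emeasurable_sum => [k w _ _|k _]; first exact: term_ge0.
apply: emeasurable_funM; last by apply: measurable_inve; exact: msum.
apply: emeasurable_funM; last exact: mwt.
apply/measurable_EFinP.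
rewrite (_ : (fun w => _) = \1_[set w | S ((fun i => Zs i w), k)]).
  by apply: measurable_indic; exact: measurable_ppr_slice.
by apply/funext => w; rewrite indicE; congr ((nat_of_bool _)%:R);
  apply/idP/idP => /set_mem h; apply/mem_set.
Qed.

Let mech_ge0 phi S w : 0 <= \sum_(k <oo) (((ind S k w)%:R : R)%:E * (wt phi k w)%:E /
     \sum_(i <oo) (wt phi i w)%:E).
Proof. by apply: nneseries_ge0 => k _ _; exact: term_ge0. Qed.

(** A factor [e^e] between densities becomes [c = e^(alpha e)] between weights, and is paid once in
    the selected weight and once in the normalizing sum. The comparison holds pointwise and term by
    term. *)
Lemma ppr_mech_pure (e : R) phi psi S :
  (forall z, 0 <= phi z)%R -> (forall z, 0 <= psi z)%R ->
  measurable_fun setT phi -> measurable_fun setT psi ->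
  (forall z, phi z <= expR e * psi z)%R -> (forall z, psi z <= expR e * phi z)%R ->
  ppr_measurable Z S ->
  mech phi S <= (expR (2 * alpha * e))%:E * mech psi S.
Proof.
move=> phi0 psi0 mphi mpsi phipsi psiphi mS; rewrite !ppr_mechE.
have alpha0 : (0 <= alpha)%R by rewrite ltW// (lt_trans ltr01).
pose c := expR (alpha * e).
have wtc (u v : Z -> R) k w : (forall z, 0 <= u z)%R -> (forall z, 0 <= v z)%R ->
    (forall z, u z <= expR e * v z)%R -> (wt u k w <= c * wt v k w)%R.
  move=> u0 v0 uv; rewrite /ppr_wt/= mulrA ler_wpM2r ?powR_ge0//.
  have -> : (c = expR e `^ alpha)%R by rewrite /c mulrC expRM.
  rewrite -powRM ?expR_ge0//.
  by apply: ge0_ler_powR; rewrite ?nnegrE ?mulr_ge0 ?expR_ge0.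
have c2 : 0 <= (expR (2 * alpha * e))%:E by rewrite lee_fin expR_ge0.
rewrite -(ge0_integralZl _ measurableT (mmech mpsi mS)
  (fun w _ => mech_ge0 psi S w) c2).
apply: ge0_le_integral => //.
- exact: mmech.
- by apply: measurable_funeM; exact: mmech.
move=> w _; rewrite -nneseriesZl//.
apply: lee_nneseries; first by move=> k _ _; exact: term_ge0.
move=> k _; rewrite -!muleA [leRHS]muleCA; apply: lee_wpmul2l.
  by rewrite lee_fin.
rewrite (_ : expR (2 * alpha * e) = c * c)%R; last first.
  by rewrite /c -expRD; congr expR; ring.
apply: le_ratio_scale.
- exact: ppr_wt_ge0.
- exact: expR_gt0.
- exact: wtc.
- by apply: (le_nneseries_term (a := fun k => wt phi k w)) => j; exact: ppr_wt_ge0.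
- by apply: (le_nneseries_term (a := fun k => wt psi k w)) => j; exact: ppr_wt_ge0.
- rewrite -nneseriesZl//; last by move=> j _; rewrite lee_fin ppr_wt_ge0.
  apply: lee_nneseries; first by move=> j _ _; rewrite lee_fin ppr_wt_ge0.
  by move=> j _; rewrite -EFinM lee_fin wtc.
Qed.

(** Integrating [le_selection] with [tau] as lower and [sigma] as upper density adds [C] times their
    integrals to the two sides. The difference is at most [delta] once [C <= 1]. *)
Lemma ppr_mech_le phi rho sigma tau S (delta : R) :
  (forall z, 0 <= tau z)%R ->
  (forall z, tau z <= phi z <= sigma z)%R ->
  (forall z, tau z <= rho z <= sigma z)%R ->
  measurable_fun setT phi -> measurable_fun setT rho ->
  measurable_fun setT sigma -> measurable_fun setT tau ->
  \int[Q]_z (phi z)%:E = 1 -> \int[Q]_z (sigma z)%:E < +oo ->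
  \int[Q]_z (sigma z - tau z)%:E <= delta%:E ->
  ppr_measurable Z S ->
  mech phi S <= mech rho S + delta%:E.
Proof.
move=> tau0 taphi taurho mphi mrho msigma mtau phi1 sigmaoo sigmatau mS.
have phi0 z : (0 <= phi z)%R by have /andP[+ _] := taphi z; exact: le_trans.
have rho0 z : (0 <= rho z)%R by have /andP[+ _] := taurho z; exact: le_trans.
have sigma0 z : (0 <= sigma z)%R by have /andP[_ +] := taphi z; exact: le_trans.
have alpha0 : (0 <= alpha)%R by rewrite ltW// (lt_trans ltr01).
have [C C0 CE] := ppr_expectation src alpha1 msigma.
pose but k w := zt_sum_but (ppr_wt sigma alpha) (zt_source Zs E w) k.
pose q u k w := (wt u k w)%:E / ((wt u k w)%:E + but k w).
have but0 k w : 0 <= but k w.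
  by apply: nneseries_ge0 => j _ _; case: ifP => // _; rewrite lee_fin ppr_wt_ge0.
have q0 u k w : 0 <= q u k w.
  by rewrite mule_ge0 ?inve_ge0 ?adde_ge0 ?lee_fin ?ppr_wt_ge0.
have mq u k : measurable_fun setT u -> measurable_fun setT (q u k).
  move=> mu; apply: emeasurable_funM; first exact: mwt.
  apply: measurable_inve; apply: emeasurable_funD; first exact: mwt.
  exact: (measurableT_comp (measurable_zt_sum_but
    (measurable_ppr_wt alpha msigma) (ppr_wt_ge0 alpha sigma) k)
    (measurable_zt_source src)).
have sq0 u w : 0 <= \sum_(k <oo) q u k w by exact: nneseries_ge0.
have msq u : measurable_fun setT u ->
    measurable_fun setT (fun w => \sum_(k <oo) q u k w).
  by move=> mu; apply: ge0_emeasurable_sum => // k _; exact: mq.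
have qE (u : Z -> R) : measurable_fun setT u -> (forall z, 0 <= u z)%R ->
    \int[Pr]_w \sum_(k <oo) q u k w = C * \int[Q]_z (u z)%:E.
  by move=> mu u0; rewrite integral_nneseries//; [exact: CE|move=> k; exact: mq].
have mwt_le (u v : Z -> R) k w : (forall z, 0 <= u z <= v z)%R ->
    (wt u k w <= wt v k w)%R.
  move=> uv; rewrite /ppr_wt/= ler_wpM2r ?powR_ge0//.
  have /andP[u0 uvz] := uv (Zs k w).
  by rewrite ge0_ler_powR// nnegrE// (le_trans u0).
(* With [tau = sigma] the ratios are normalized weights, whose sum is at most 1 everywhere. *)
have Csigma : C * \int[Q]_z (sigma z)%:E <= 1.
  rewrite -qE//; apply: (@le_trans _ _ (\int[Pr]_w (cst 1 w))); last first.
    by rewrite integral_cst//= mul1e [X in X <= _]probability_setT.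
  apply: ge0_le_integral => //; first exact: msq.
  move=> w _; apply: le_trans (nneseries_normalized_le1
    (a := fun k => wt sigma k w) (fun k => ppr_wt_ge0 _ _ _)).
  apply: lee_nneseries => // k _; rewrite /q.
  rewrite [X in _ <= _ / X](@nneseriesD1 R (fun k => (wt sigma k w)%:E) k xpredT)//;
    last by move=> j _; rewrite lee_fin ppr_wt_ge0.
  rewrite (_ : but k w = \sum_(0 <= j <oo | true && (j != k)) (wt sigma j w)%:E)//.
  by rewrite eseries_mkcond; apply: eq_eseriesr => j _ /=; case: eqP.
(* The integral of [sigma] is at least that of [phi], which is 1. *)
have C1 : C <= 1.
  apply: le_trans Csigma; rewrite -[leLHS]mule1 lee_wpmul2l// -phi1.
  apply: ge0_le_integral => //; try by move=> z _; rewrite lee_fin.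
  - exact/measurable_EFinP.
  - exact/measurable_EFinP.
  - by move=> z _; rewrite lee_fin; have /andP[] := taphi z.
have st0 z : (0 <= sigma z - tau z)%R.
  by rewrite subr_ge0; have /andP[+ ] := taphi z; exact: le_trans.
have mst : measurable_fun setT (fun z => (sigma z - tau z)%:E).
  by apply/measurable_EFinP; exact: measurable_funB.
have sigmaE : \int[Q]_z (sigma z)%:E =
    \int[Q]_z (tau z)%:E + \int[Q]_z (sigma z - tau z)%:E.
  rewrite -ge0_integralD//; try by move=> z _; rewrite lee_fin.
  - by apply: eq_integral => z _; rewrite -EFinD addrC subrK.
  - exact/measurable_EFinP.
have main : mech phi S + C * \int[Q]_z (tau z)%:E <=
    mech rho S + C * \int[Q]_z (sigma z)%:E.
  rewrite -(qE tau mtau tau0) -(qE sigma msigma sigma0).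
  have addI u v : measurable_fun setT u -> measurable_fun setT v ->
      mech u S + \int[Pr]_w \sum_(k <oo) q v k w = \int[Pr]_w
      (\sum_(k <oo) (((ind S k w)%:R : R)%:E * (wt u k w)%:E /
         \sum_(i <oo) (wt u i w)%:E) + \sum_(k <oo) q v k w).
    move=> mu mv; exact: esym (ge0_integralD Pr measurableT
      (fun w _ => mech_ge0 u S w) (mmech mu mS) (fun w _ => sq0 v w) (msq v mv)).
  rewrite [leLHS](addI phi tau mphi mtau) [leRHS](addI rho sigma mrho msigma).
  apply: ae_ge0_le_integral => //.
  - by move=> w _; rewrite adde_ge0 ?mech_ge0 ?sq0.
  - by apply: emeasurable_funD; [exact: mmech|exact: msq].
  - by move=> w _; rewrite adde_ge0 ?mech_ge0 ?sq0.
  - by apply: emeasurable_funD; [exact: mmech|exact: msq].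
  (* [le_selection] needs a finite sum of [sigma]-weights, which holds almost surely. *)
  apply: filterS (ppr_sum_lty src alpha1 sigma0 msigma sigmaoo) => w Moo _.
  apply: (@le_selection R (fun k => wt phi k w) (fun k => wt rho k w)
    (fun k => wt sigma k w) (fun k => wt tau k w) (fun k => ind S k w)) => //.
  - by move=> k; exact: ppr_wt_ge0.
  - move=> k; apply/andP; split; apply: mwt_le => z.
      by rewrite tau0; have /andP[] := taphi z.
    by rewrite phi0; have /andP[] := taphi z.
  - move=> k; apply/andP; split; apply: mwt_le => z.
      by rewrite tau0; have /andP[] := taurho z.
    by rewrite rho0; have /andP[] := taurho z.
have tauint0 : 0 <= \int[Q]_z (tau z)%:E.
  by apply: integral_ge0 => z _; rewrite lee_fin.
have stint0 : 0 <= \int[Q]_z (sigma z - tau z)%:E.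
  by apply: integral_ge0 => z _; rewrite lee_fin.
(* This term occurs on both sides of [main] after splitting [sigma] as [tau + (sigma - tau)]; being
   finite, it cancels. *)
have Ctaufin : C * \int[Q]_z (tau z)%:E \is a fin_num.
  rewrite ge0_fin_numE ?mule_ge0//; apply: le_lt_trans (ltry 1).
  apply: le_trans Csigma; rewrite lee_wpmul2l// sigmaE leeDl//.
move: main; rewrite sigmaE.
move: (mech phi S) (mech rho S) (\int[Q]_z (tau z)%:E)
  (\int[Q]_z (sigma z - tau z)%:E) tauint0 stint0 Ctaufin sigmatau.
move=> a b t r t0 r0 Ctfin rdelta.
rewrite ge0_muleDr// [leRHS]addeCA [leLHS]addeC leeD2lE// => /le_trans; apply.
rewrite leeD2l//; apply: le_trans rdelta.
by rewrite -[leRHS]mul1e lee_wpmul2r.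
Qed.

End ppr_mech.

(** * Differential privacy *)

(* The truncation of a density [f] to the band [[g / e, e g]] where the pure
   privacy bound holds. *)
Definition band {R : realType} (e f g : R) : R :=
  Num.min (Num.max f (e^-1 * g)) (e * g).

(** The last bound controls the distance from [f] to the band: lowering costs [f - e * g], raising
    costs [e^-1 * g - f], and each is covered by one positive part. *)
Lemma band_bounds {R : realType} (e f g : R) : 1 <= e -> 0 <= f -> 0 <= g ->
  [/\ 0 <= band e f g, band e f g <= e * g, g <= e * band e f g &
    Num.max f (band e f g) - Num.min f (band e f g) <=
      Num.max 0 (f - e * g) + Num.max 0 (g - e * f)].
Proof.
move=> e1 f0 g0; have e0 : 0 < e by exact: lt_le_trans e1.
have ei0 : 0 < e^-1 by rewrite invr_gt0.
have ei1 : e^-1 <= 1 by rewrite invf_le1.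
have gE : e * (e^-1 * g) = g by rewrite mulrA divff ?mul1r// gt_eqF.
have h1 : e^-1 * g <= g by rewrite ler_piMl.
have h2 : g <= e * g by rewrite ler_peMl.
have h3 : 0 <= e^-1 * g by rewrite mulr_ge0// ltW.
have h4 : 0 <= e * f by rewrite mulr_ge0// ltW.
have b0 : e^-1 * g <= band e f g.
  by rewrite /band le_min le_max lexx orbT/= (le_trans h1).
split.
- exact: le_trans b0.
- by rewrite /band ge_min lexx orbT.
- by rewrite -[leLHS]gE ler_pM2l.
(* The left side is [e^-1 * (g - e * f)], and [e^-1 <= 1]. *)
have h5 : e^-1 * g - f <= Num.max 0 (g - e * f).
  have : e^-1 * (g - e * f) <= Num.max 0 (g - e * f).
    case: (leP (g - e * f) 0) => h.
      by rewrite pmulr_rle0.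
    by rewrite ler_piMl// ltW.
  by rewrite mulrBr mulrA mulVf ?mul1r// gt_eqF.
have m1 : 0 <= Num.max 0 (f - e * g) by rewrite le_max lexx.
have m2 : 0 <= Num.max 0 (g - e * f) by rewrite le_max lexx.
have m3 : f - e * g <= Num.max 0 (f - e * g) by rewrite le_max lexx orbT.
rewrite /band; move: h5 m1 m2 m3 h1 h2.
move: (Num.max 0 (f - e * g)) (Num.max 0 (g - e * f)) (e * g) (e^-1 * g).
move=> u v eg eig h5 m1 m2 m3 h1 h2.
by case: (leP f eig) => ?; case: (leP _ eg) => ?; case: (leP f _) => ?; lra.
Qed.

Theorem theorem3 (R : realType) (X : Type) (N : X -> X -> Prop)
  (d : measure_display) (Z : measurableType d)
  (Q : probability Z R) (P : X -> probability Z R) (f : X -> Z -> R)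
  (eps delta alpha : R)
  (dO : measure_display) (Omega : measurableType dO) (Pr : probability Omega R)
  (Zs : nat -> Omega -> Z) (E : nat -> Omega -> R) :
  symmetric_rel N ->
  (* f x is (a version of) the density dP(.|x)/dQ, so P(.|x) << Q *)
  (forall x z, 0 <= f x z) ->
  (forall x, measurable_fun setT (f x)) ->
  (forall x A, measurable A -> P x A = (\int[Q]_(z in A) (f x z)%:E)%E) ->
  0 <= eps -> 0 <= delta ->
  ppr_source Pr Q Zs E ->
  DP measurable N P eps delta ->
  1 < alpha ->
  DP (ppr_measurable Z) N (ppr_mech Pr Zs E f alpha) (2 * alpha * eps) (2 * delta).
Proof.
move=> Nsym f0 mf fP eps0 delta0 src DPP alpha1 x x' Nxx' S mS.
have e1 : 1 <= expR eps by rewrite -expR0 ler_expR.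
pose rho z := band (expR eps) (f x z) (f x' z).
pose sigma z := Num.max (f x z) (rho z).
pose tau z := Num.min (f x z) (rho z).
have B z := band_bounds e1 (f0 x z) (f0 x' z).
have rho0 z : 0 <= rho z by have [] := B z.
have mrho : measurable_fun setT rho.
  apply: measurable_minr; last exact: measurable_funM.
  by apply: measurable_maxr => //; exact: measurable_funM.
have msigma : measurable_fun setT sigma by exact: measurable_maxr.
have mtau : measurable_fun setT tau by exact: measurable_minr.
have int1 y : (\int[Q]_z (f y z)%:E = 1)%E.
  by rewrite -fP// probability_setT.
have mexc y y' : measurable_fun setT
    (fun z => (Num.max 0 (f y z - expR eps * f y' z))%:E).
  apply/measurable_EFinP; apply: measurable_maxr => //.
  by apply: measurable_funB => //; exact: measurable_funM.
have exc y y' : N y y' ->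
    (\int[Q]_z (Num.max 0 (f y z - expR eps * f y' z))%:E <= delta%:E)%E.
  move=> Nyy'.
  apply: (density_excess (f0 y') (mf y) (mf y') (fP y) (fP y')
    (expR_ge0 eps)) => A mA; exact: DPP.
(* The truncated density is the intermediate point: the additive loss arises between [f x] and
   [rho], the multiplicative one between [rho] and [f x']. *)
apply: (@le_trans _ _
    (ppr_mech Pr Zs E (@idfun (Z -> R)) alpha rho S + (2 * delta)%:E)%E).
  apply: (@ppr_mech_le _ _ _ _ _ Pr Q Zs E src alpha alpha1 (f x) rho sigma tau) => //.
  - by move=> z; rewrite /tau le_min f0 rho0.
  - by move=> z; rewrite /tau /sigma ge_min lexx le_max lexx.
  - by move=> z; rewrite /tau /sigma ge_min lexx orbT le_max lexx orbT.
  (* [sigma] is dominated by [f x + e^eps * f x'], of total mass [1 + e^eps]. *)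
  - apply: (@le_lt_trans _ _ (\int[Q]_z ((f x z)%:E + (expR eps)%:E * (f x' z)%:E))%E).
      apply: ge0_le_integral => //.
      + by move=> z _; rewrite lee_fin /sigma le_max f0.
      + exact/measurable_EFinP.
      + apply: emeasurable_funD; first exact/measurable_EFinP.
        by apply: measurable_funeM; exact/measurable_EFinP.
      + move=> z _; rewrite -EFinM -EFinD lee_fin /sigma ge_max.
        have [_ rg _ _] := B z.
        rewrite lerDl mulr_ge0 ?expR_ge0//=.
        by rewrite (le_trans rg)// lerDr.
    have fe0 y z : setT z -> (0 <= (f y z)%:E)%E by rewrite lee_fin.
    have mfe y : measurable_fun setT (fun z => (f y z)%:E).
      exact/measurable_EFinP.
    have c0 : (0 <= (expR eps)%:E)%E by rewrite lee_fin expR_ge0.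
    rewrite (ge0_integralD Q measurableT (fe0 x) (mfe x)
      (fun z zT => mule_ge0 c0 (fe0 x' z zT)) (measurable_funeM _ (mfe x'))).
    rewrite (ge0_integralZl Q measurableT (mfe x') (fe0 x') c0).
    by rewrite !int1 mule1 -EFinD ltry.
  (* Each of the two excesses integrates to at most [delta]; the second uses the privacy bound for
     the reversed pair, given by symmetry. *)
  - apply: (@le_trans _ _ (\int[Q]_z
      ((Num.max 0 (f x z - expR eps * f x' z))%:E +
       (Num.max 0 (f x' z - expR eps * f x z))%:E))%E).
      apply: ge0_le_integral => //.
      + move=> z _; rewrite lee_fin subr_ge0 /tau /sigma.
        by rewrite ge_min le_max lexx.
      + by apply/measurable_EFinP; exact: measurable_funB.
      + exact: emeasurable_funD.
      + by move=> z _; rewrite -EFinD lee_fin; have [] := B z.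
    rewrite ge0_integralD//; try by move=> z _; rewrite lee_fin le_max lexx.
    rewrite mulrDl mul1r EFinD; apply: leeD; first exact: exc.
    by apply: exc; exact: Nsym.
rewrite leeD2r//.
apply: (@ppr_mech_pure _ _ _ _ _ Pr Q Zs E src alpha alpha1 eps rho (f x') S) => //.
- by move=> z; have [] := B z.
- by move=> z; have [] := B z.
Qed.
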